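(* Let $X_1,X_2,\ldots$ be independent real random variables with common probability density $f:\mathbb{R}\to[0,\infty)$. Assume that $f\in L^2(\mathbb{R})$ and that $f$ has a weak second derivative $f''\in L^2(\mathbb{R})$. Let $K:\mathbb{R}\to\mathbb{R}$ satisfy $K\in L^1(\mathbb{R})\cap L^2(\mathbb{R})$, $\int_{\mathbb{R}}K(u)\,du=1$, $\int_{\mathbb{R}}uK(u)\,du=0$ and $\int_{\mathbb{R}}u^2|K(u)|\,du<\infty$. If $h=h_n>0$ satisfies $h_n\to0$ and $nh_n\to\infty$ as $n\to\infty$, then $$\operatorname{MISE}(\widehat f_h)=\frac{h^4}{4}\mu_2(K)^2R(f'')+\frac{R(K)}{nh}+o(h^4)+O(n^{-1}),$$ where $\mu_2(K)=\int_{\mathbb{R}}u^2K(u)\,du$, $R(f'')=\|f''\|_2^2=\int_{\mathbb{R}}\{f''(x)\}^2\,dx$ and $R(K)=\int_{\mathbb{R}}K(u)^2\,du$. In particular, $$\operatorname{MISE}(\widehat f_h)=\frac{h^4}{4}\mu_2(K)^2R(f'')+\frac{R(K)}{nh}+o\bigl(h^4+(nh)^{-1}\bigr).$$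
   Context: The kernel density estimator based on $X_1,\ldots,X_n$ is $\widehat f_h(x)=\frac1{nh}\sum_{i=1}^nK\left(\frac{x-X_i}{h}\right)$. Its mean integrated squared error is $\operatorname{MISE}(\widehat f_h)=\mathbb{E}\int_{\mathbb{R}}\{\widehat f_h(x)-f(x)\}^2\,dx$. The kernel may take negative values. A function $g\in L^1_{\mathrm{loc}}(\mathbb{R})$ is the weak second derivative of $f$, written $g=f''$, if $\int g\varphi\,dx=\int f\varphi''\,dx$ for every smooth compactly supported $\varphi$. Functions equal almost everywhere are identified. *)

(* Defs.v *)
From HB Require Import structures.
From mathcomp Require Import all_boot all_order all_algebra.
From mathcomp Require Import all_classical all_reals all_analysis.

Set Implicit Arguments.
Unset Strict Implicit.
Unset Printing Implicit Defensive.

Import Order.TTheory GRing.Theory Num.Theory.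
Import numFieldNormedType.Exports.

Local Open Scope classical_set_scope.
Local Open Scope ring_scope.

Definition mutually_independent (d : measure_display) (Omega : measurableType d)
    (R : realType) (P : probability Omega R) (X : nat -> {RV P >-> R}) : Prop :=
  forall (J : seq nat) (A : nat -> set R),
    uniq J -> (forall i, measurable (A i)) ->
    P (\bigcap_(i in [set` J]) (X i @^-1` A i)) =
    (\prod_(i <- J) P (X i @^-1` A i))%E.

Definition has_density (d : measure_display) (Omega : measurableType d)
    (R : realType) (P : probability Omega R) (X : {RV P >-> R}) (f : R -> R)
    : Prop :=
  [/\ measurable_fun setT f, forall x, 0 <= f x &
      forall A : set R, measurable A ->
        distribution P X A = (\int[lebesgue_measure]_(x in A) (f x)%:E)%E].

Definition test_function (R : realType) (phi : R -> R) : Prop :=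
  (forall (k : nat) (x : R), derivable (phi^`(k))%classic x 1) /\
  compact (closure [set x | phi x != 0]).

Definition weak_second_derivative (R : realType) (f g : R -> R) : Prop :=
  [/\ locally_integrable setT f, locally_integrable setT g &
      forall phi : R -> R, test_function phi ->
        \int[lebesgue_measure]_x (g x * phi x) =
        \int[lebesgue_measure]_x (f x * (phi^`(2))%classic x)].

(* The sample X_1, ..., X_n is X 0, ..., X n.-1. *)
Definition kde (R : realType) (Omega : Type) (K : R -> R)
    (X : nat -> Omega -> R) (n : nat) (h : R) (w : Omega) (x : R) : R :=
  (n%:R * h)^-1 * \sum_(i < n) K ((x - X i w) / h).

(* Both integrands are nonnegative, so the iterated integral is taken in
   [0, +oo] and needs no integrability proviso. *)
Definition MISE (d : measure_display) (Omega : measurableType d)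
    (R : realType) (P : probability Omega R) (K : R -> R)
    (X : nat -> Omega -> R) (f : R -> R) (n : nat) (h : R) : \bar R :=
  (\int[P]_w \int[lebesgue_measure]_x ((kde K X n h w x - f x) ^+ 2)%:E)%E.

Definition mu2 (R : realType) (K : R -> R) : R :=
  \int[lebesgue_measure]_u (u ^+ 2 * K u).

Definition roughness (R : realType) (g : R -> R) : R :=
  \int[lebesgue_measure]_x (g x ^+ 2).

(* Main.v *)
Require Import Defs.
From HB Require Import structures.
From mathcomp Require Import all_boot all_order all_algebra.
From mathcomp Require Import all_classical all_reals all_analysis.
From mathcomp Require Import measurable_realfun ring lra.

Import Order.TTheory GRing.Theory Num.Theory.
Import numFieldNormedType.Exports.

Local Open Scope classical_set_scope.
Local Open Scope ring_scope.

(** By Tonelli's theorem the mean integrated squared error is the integral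
    over x of the mean square error at x. At a fixed x the estimator is the
    average of n independent copies of h^-1 K ((x - X) / h), whose mean is
    m(x) = int K(u) f(x - h u) du and whose second moment is
    v(x) = h^-1 int K(u)^2 f(x - h u) du, so the mean square error is
    (m - f)^2 + (v - m^2) / n ([mean_square_error_pointwise]). The integral of
    v is exactly R(K) / h, and the integral of m^2 is bounded independently of
    h ([kernel_mean_sqr_le]): divided by n, it is the O(1/n) term
    ([mise_decomposition]).

    The squared bias, the integral of (m - f)^2, remains. Since f'' exists only
    weakly, Taylor's formula for f comes by duality. For a smooth phi, the
    difference phi(x + s) - phi(x) - s phi'(x) is an average of values of phi'';
    integrated against f, each of these can be moved onto f2
    ([weak_taylor]). The bumps exp(-1/y) exp(-1/z), with y and z proportional
    to the distances to the ends of an interval, increase to the indicator of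
    that interval, so pairings with them determine a function almost everywhere
    ([bump_orthogonal_ae0]). The first derivative of f is not among the data:
    the formula at s = 1 produces it ([taylor_slope]). Hence, for every s and
    almost every x,

      f(x - s) - f(x) + s f'(x) = s^2 int_0^1 (1 - t) f2(x - t s) dt.

    A weighted Cauchy-Schwarz inequality ([integral_weighted_cauchy_schwarz])
    bounds the mean square of the right-hand side over s^2, minus f2(x) / 2, by
    an average of the squared norms of the f2(. - t s) - f2; these tend to 0
    with s, translations being continuous in mean square
    ([L2_translation_cvg], [taylor_defect_cvg]).

    As K has integral 1 and mean 0, the function m - f - h^2 mu2(K) / 2 f2 is
    the integral in u of h^2 u^2 K(u) times this Taylor defect at s = h u.
    The same Cauchy-Schwarz inequality and dominated convergence, with the
    finite measure u^2 |K(u)| du, show that its squared norm is o(h^4)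
    ([bias_error_small]). So the squared norm of m - f is that of
    h^2 mu2(K) / 2 f2 up to o(h^4) ([bias_expansion]). *)

Set Implicit Arguments.
Unset Strict Implicit.
Unset Printing Implicit Defensive.

Notation leb := lebesgue_measure.

(** * Integration of real functions *)

Section integrable_real.
Context d (T : measurableType d) (R : realType) (m : {measure set T -> \bar R}).

Lemma integrable_cMl (c : R) (g : T -> R) :
  m.-integrable setT (EFin \o g) -> m.-integrable setT (EFin \o (fun x => c * g x)).
Proof. by move=> ig; have := integrableZl measurableT c ig; apply: eq_integrable. Qed.

Lemma integrable_addr (g k : T -> R) :
  m.-integrable setT (EFin \o g) -> m.-integrable setT (EFin \o k) ->
  m.-integrable setT (EFin \o (fun x => g x + k x)).
Proof. by move=> ig ik; have := integrableD measurableT ig ik; apply: eq_integrable. Qed.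

Lemma integrable_subr (g k : T -> R) :
  m.-integrable setT (EFin \o g) -> m.-integrable setT (EFin \o k) ->
  m.-integrable setT (EFin \o (fun x => g x - k x)).
Proof. by move=> ig ik; have := integrableB measurableT ig ik; apply: eq_integrable. Qed.

End integrable_real.
Arguments integrable_cMl {d T R m} c g _.
Arguments integrable_addr {d T R m} g k _ _.
Arguments integrable_subr {d T R m} g k _ _.

Lemma measurable_Rintegral d1 d2 (T1 : measurableType d1) (T2 : measurableType d2)
    (R : realType) (m1 : {sigma_finite_measure set T1 -> \bar R})
    (F : T1 * T2 -> R) :
  measurable_fun setT F ->
  measurable_fun setT (fun y => \int[m1]_x F (x, y)).
Proof.
move=> mF; apply: measurableT_comp; first exact: fine_measurable.
have mE : measurable_fun setT (EFin \o F) by exact/measurable_EFinP.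
under eq_fun do rewrite integralE.
apply: emeasurable_funB.
- rewrite [X in measurable_fun _ X](_ : _ = fubini_G m1 (EFin \o F)^\+%E).
    by apply: measurable_fun_fubini_tonelli_G => //; exact: measurable_funepos.
  by apply/funext => y; apply: eq_integral => x _; rewrite !funeposE.
- rewrite [X in measurable_fun _ X](_ : _ = fubini_G m1 (EFin \o F)^\-%E).
    by apply: measurable_fun_fubini_tonelli_G => //; exact: measurable_funeneg.
  by apply/funext => y; apply: eq_integral => x _; rewrite !funenegE.
Qed.

(** Integrating the inequality 2 |k F| <= l |k| + l^-1 |k| F^2 bounds the
    integral of |k F| for every l > 0; the best l is that integral over C. When
    k F is not integrable its [Rintegral] may be 0, which only helps. *)
Lemma weighted_cauchy_schwarz d (T : measurableType d) (R : realType)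
    (m : {measure set T -> \bar R}) (k F : T -> R) (C : R) :
  measurable_fun setT k -> measurable_fun setT F ->
  0 < C -> (\int[m]_u `|k u|%:E <= C%:E)%E ->
  (((\int[m]_u (k u * F u)) ^+ 2)%:E <=
     C%:E * \int[m]_u (`|k u| * F u ^+ 2)%:E)%E.
Proof.
move=> mk mF C0 kC.
have mkF : measurable_fun setT (fun u => k u * F u) by exact: measurable_funM.
have mak : measurable_fun setT (fun u => `|k u|) by exact: measurableT_comp.
have mkF2 : measurable_fun setT (fun u => `|k u| * F u ^+ 2).
  by apply: measurable_funM => //; exact: measurable_funX.
have Q0 : (0 <= \int[m]_u (`|k u| * F u ^+ 2)%:E)%E.
  by apply: integral_ge0 => u _; rewrite lee_fin mulr_ge0 ?sqr_ge0.
have [->|Qfin] := eqVneq (\int[m]_u (`|k u| * F u ^+ 2)%:E)%E +oo%E.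
  by rewrite gt0_muley ?lte_fin // leey.
have {Qfin} Qfin : (\int[m]_u (`|k u| * F u ^+ 2)%:E)%E \is a fin_num.
  by rewrite ge0_fin_numE // lt_neqAle Qfin leey.
move: Q0; rewrite -(fineK Qfin); set q := fine _ => q0; rewrite lee_fin in q0.
pose A := (\int[m]_u `|k u * F u|%:E)%E.
have young (l : R) : 0 < l -> (A <= ((l * C + q / l) / 2)%:E)%E.
  move=> l0.
  apply: (@le_trans _ _ (\int[m]_u ((l / 2)%:E * `|k u|%:E
      + ((l * 2)^-1)%:E * (`|k u| * F u ^+ 2)%:E))%E).
    apply: ge0_le_integral => //.
    - by apply/measurable_EFinP; exact: measurableT_comp.
    - apply: emeasurable_funD; apply: emeasurable_funM => //; exact/measurable_EFinP.
    - move=> u _; rewrite -!EFinM -EFinD lee_fin normrM.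
      rewrite -(real_normK (num_real (F u))).
      have := normr_ge0 (k u); have := normr_ge0 (F u).
      move: `|k u| `|F u| => a b b0 a0.
      have -> : l / 2 * a + (l * 2)^-1 * (a * b ^+ 2) = a * ((l^+2 + b^+2) / (l * 2)).
        by field; rewrite gt_eqF.
      apply: ler_wpM2l => //; rewrite ler_pdivlMr ?mulr_gt0 //; have := sqr_ge0 (l - b); nra.
  have l20 : 0 <= l / 2 by rewrite divr_ge0 // ltW.
  have l2i : 0 <= (l * 2)^-1 by rewrite invr_ge0 mulr_ge0 // ltW.
  have mk' : measurable_fun setT (fun u => `|k u|%:E) by exact/measurable_EFinP.
  have mq' : measurable_fun setT (fun u => (`|k u| * F u ^+ 2)%:E) by exact/measurable_EFinP.
  rewrite ge0_integralD //.
  - rewrite !ge0_integralZl //; first last.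
      by move=> u _; rewrite lee_fin mulr_ge0 ?sqr_ge0.
    rewrite -(fineK Qfin) -/q.
    apply: (@le_trans _ _ ((l / 2)%:E * C%:E + ((l * 2)^-1)%:E * q%:E)%E).
      by apply: leeD => //; apply: lee_wpmul2l => //; rewrite lee_fin.
    rewrite -!EFinM -EFinD lee_fin le_eqVlt; apply/orP; left; apply/eqP.
    by field; rewrite gt_eqF.
  - by move=> u _; rewrite -EFinM lee_fin mulr_ge0.
  - by apply: emeasurable_funM.
  - by move=> u _; rewrite -EFinM lee_fin mulr_ge0 // mulr_ge0 ?sqr_ge0.
  - by apply: emeasurable_funM.
have A0 : (0 <= A)%E by exact: integral_ge0.
have Afin : A \is a fin_num.
  by rewrite ge0_fin_numE // (le_lt_trans (young 1 ltr01)) // ltry.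
have aI : `|\int[m]_u (k u * F u)| <= fine A.
  rewrite -lee_fin fineK // /Rintegral.
  have H := @le_abse_integral _ _ _ m setT (fun u => (k u * F u)%:E) measurableT.
  apply: le_trans (H _); last exact/measurable_EFinP.
  by case: (\int[m]_u _)%E => [r||] //=; rewrite normr0 leey.
rewrite -EFinM lee_fin -(real_normK (num_real (\int[m]_u (k u * F u)))).
move: A0 aI young; rewrite -(fineK Afin); move: (fine A) => a.
rewrite lee_fin /= => a0 aI young.
apply: (@le_trans _ _ (a ^+ 2)); first by apply: lerXn2r; rewrite ?nnegrE.
have [a00|an0] := eqVneq a 0; first by rewrite a00 expr0n /= mulr_ge0 // ltW.
have ap : 0 < a by rewrite lt_neqAle eq_sym an0.
have := young (a / C) (divr_gt0 ap C0); rewrite lee_fin.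
have -> : (a / C * C + q / (a / C)) / 2 = (a ^+ 2 + C * q) / (2 * a).
  by field; rewrite !gt_eqF.
by rewrite ler_pdivlMr ?mulr_gt0 //; nra.
Qed.

(** Takes the place of Minkowski's integral inequality: it bounds the
    mean square of a superposition by the superposition of the mean squares. *)
Lemma integral_weighted_cauchy_schwarz d1 d2 (T1 : measurableType d1)
    (T2 : measurableType d2) (R : realType)
    (m1 : {sigma_finite_measure set T1 -> \bar R})
    (m2 : {sigma_finite_measure set T2 -> \bar R})
    (k : T1 -> R) (F : T1 * T2 -> R) (C : R) :
  measurable_fun setT k -> measurable_fun setT F ->
  0 < C -> (\int[m1]_u `|k u|%:E <= C%:E)%E ->
  (\int[m2]_x ((\int[m1]_u (k u * F (u, x))) ^+ 2)%:E <=
     C%:E * \int[m1]_u (`|k u|%:E * \int[m2]_x (F (u, x) ^+ 2)%:E))%E.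
Proof.
move=> mk mF C0 kC.
have mk1 : measurable_fun setT (fun z : T1 * T2 => k z.1) by exact: measurableT_comp.
have mkF : measurable_fun setT (fun z : T1 * T2 => k z.1 * F z).
  exact: measurable_funM.
have mkF2 : measurable_fun setT (fun z : T1 * T2 => (`|k z.1| * F z ^+ 2)%:E).
  apply/measurable_EFinP; apply: measurable_funM; last exact: measurable_funX.
  exact: measurableT_comp.
have kF2 z : (0 <= (`|k z.1| * F z ^+ 2)%:E)%E by rewrite lee_fin mulr_ge0 ?sqr_ge0.
apply: (@le_trans _ _ (\int[m2]_x (C%:E * \int[m1]_u (`|k u| * F (u, x) ^+ 2)%:E))%E).
  apply: ge0_le_integral => //.
  - by move=> x _; rewrite lee_fin sqr_ge0.
  - apply/measurable_EFinP; apply: measurable_funX.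
    exact: (@measurable_Rintegral _ _ _ _ _ m1 (fun z => k z.1 * F z)).
  - apply: emeasurable_funM => //.
    exact: (@measurable_fun_fubini_tonelli_G _ _ _ _ _ m1
              (fun z => (`|k z.1| * F z ^+ 2)%:E)).
  - move=> x _; apply: weighted_cauchy_schwarz => //.
    exact: measurableT_comp.
rewrite ge0_integralZl //; last 3 first.
- exact: (@measurable_fun_fubini_tonelli_G _ _ _ _ _ m1
              (fun z => (`|k z.1| * F z ^+ 2)%:E)).
- by move=> x _; apply: integral_ge0 => u _; exact: (kF2 (u, x)).
- by rewrite lee_fin ltW.
apply: lee_wpmul2l; first by rewrite lee_fin ltW.
rewrite -(@fubini_tonelli _ _ _ _ _ m1 m2 (fun z => (`|k z.1| * F z ^+ 2)%:E)) //=.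
rewrite le_eqVlt; apply/orP; left; apply/eqP.
apply: eq_integral => u _; rewrite -ge0_integralZl //.
- apply/measurable_EFinP; apply: measurable_funX; exact: measurableT_comp.
- by move=> x _; rewrite lee_fin sqr_ge0.
Qed.

Section real_fubini.
Context d1 d2 (T1 : measurableType d1) (T2 : measurableType d2) (R : realType)
  (m1 : {sigma_finite_measure set T1 -> \bar R})
  (m2 : {sigma_finite_measure set T2 -> \bar R}) (F : T1 * T2 -> R).
Hypothesis iF : (m1 \x m2)%E.-integrable setT (EFin \o F).

Let mF : measurable_fun setT F.
Proof. by case/integrableP: iF => /measurable_EFinP. Qed.

Lemma integrable_Rintegral1 :
  m1.-integrable setT (EFin \o (fun x => \int[m2]_y F (x, y))).
Proof.
have i1 := integrable_fubini_F iF.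
apply/integrableP; split.
  apply/measurable_EFinP/measurableT_comp; first exact: fine_measurable.
  by case/integrableP: i1.
case/integrableP: i1 => m1F; apply: le_lt_trans.
apply: ge0_le_integral => //.
- apply: measurableT_comp => //; apply: measurableT_comp => //.
  by apply: measurableT_comp => //; exact: fine_measurable.
- exact: measurableT_comp.
- by move=> x _; rewrite /fubini_F /Rintegral /=;
    case: (\int[m2]_y _)%E => [r||] //=; rewrite normr0 leey.
Qed.

Lemma Rintegral_fubini :
  \int[m1]_x \int[m2]_y F (x, y) = \int[m2]_y \int[m1]_x F (x, y).
Proof.
rewrite /Rintegral; congr fine.
transitivity (\int[m1]_x \int[m2]_y (F (x, y))%:E)%E.
  apply: ae_eq_integral => //.
  - by apply/measurable_EFinP; case/integrableP: integrable_Rintegral1 => /measurable_EFinP.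
  - exact: (measurable_fubini_F iF).
  - apply: filterS (ae_integrable1 iF) => x ix _.
    by rewrite fineK // integrable_fin_num.
rewrite (Fubini iF).
apply: ae_eq_integral => //.
- exact: (measurable_fubini_G iF).
- apply/measurable_EFinP.
  exact: (@measurable_Rintegral _ _ _ _ _ m1 F).
- apply: filterS (ae_integrable2 iF) => x ix _.
  by rewrite fineK // integrable_fin_num.
Qed.

End real_fubini.

(** The form in which integrability on a product is checked below: the inner
    integral is always at most an integrable weight times a constant. *)
Lemma integrable_prod_bound d1 d2 (T1 : measurableType d1) (T2 : measurableType d2)
    (R : realType) (m1 : {sigma_finite_measure set T1 -> \bar R})
    (m2 : {sigma_finite_measure set T2 -> \bar R})
    (F : T1 * T2 -> R) (k : T1 -> R) (C : R) :
  measurable_fun setT F -> m1.-integrable setT (EFin \o k) ->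
  (forall x, (\int[m2]_y `|F (x, y)|%:E <= (`|k x| * C)%:E)%E) ->
  (m1 \x m2)%E.-integrable setT (EFin \o F).
Proof.
move=> mF ik H; apply/integrable12ltyP; first exact/measurable_EFinP.
have [mk _] := integrableP _ _ _ ik.
have ikC : m1.-integrable setT (fun x => (`|k x|)%:E * C%:E)%E.
  apply: integrableZr => //; exact: (integrable_abse ik).
case/integrableP: ikC => mkC; apply: le_lt_trans.
apply: ge0_le_integral => //.
- by move=> x _; exact: integral_ge0.
- apply: (@measurable_fun_fubini_tonelli_F _ _ _ _ _ m2 (fun z => `|F z|%:E)) => //.
  by apply/measurable_EFinP; exact: measurableT_comp.
- exact: measurableT_comp.
- by move=> x _; apply: le_trans (H x) _; rewrite EFinM; exact: lee_abs.
Qed.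

Lemma integrable_mul_bounded d (T : measurableType d) (R : realType)
    (m : {measure set T -> \bar R}) (k g : T -> R) (M : R) :
  m.-integrable setT (EFin \o k) -> measurable_fun setT g ->
  (forall x, `|g x| <= M) -> m.-integrable setT (EFin \o (fun x => k x * g x)).
Proof.
move=> ik mg gM.
have mk : measurable_fun setT k by case/integrableP : ik => /measurable_EFinP.
have ikM : m.-integrable setT (fun x => (`|k x|)%:E * M%:E)%E.
  apply: integrableZr => //; exact: (integrable_abse ik).
apply: le_integrable ikM => //.
  by apply/measurable_EFinP; exact: measurable_funM.
move=> x _; rewrite -EFinM /= lee_fin !normrM normr_id ler_wpM2l //.
by rewrite (le_trans (gM x)) // ler_norm.
Qed.

(** A measurable real function that is
    not integrable has an infinite integral, hence [Rintegral] 0, and so do its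
    nonzero multiples. This lets constants move out of inner integrals that are
    finite only almost everywhere. *)
Lemma Rintegral_cMl d (T : measurableType d) (R : realType)
    (m : {measure set T -> \bar R}) (g : T -> R) (c : R) :
  measurable_fun setT g -> \int[m]_x (c * g x) = c * \int[m]_x g x.
Proof.
move=> mg; have [->|c0] := eqVneq c 0.
  by rewrite mul0r; under eq_Rintegral do rewrite mul0r; rewrite Rintegral_cst // mul0r.
have [ig|nig] := pselect (m.-integrable setT (EFin \o g)); first exact: RintegralZl.
have junk (k : T -> R) : measurable_fun setT k -> ~ m.-integrable setT (EFin \o k) ->
    \int[m]_x k x = 0.
  move=> mk nk; have mE : measurable_fun setT (EFin \o k) by exact/measurable_EFinP.
  have := @integral_fin_num_abs _ _ _ m setT k measurableT mk.
  have -> : (\int[m]_x `|(k x)%:E| < +oo)%E = false.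
    by apply/negP => klty; apply: nk; apply/integrableP.
  by rewrite /Rintegral; case: (\int[m]_x _)%E.
rewrite (junk _ mg nig) mulr0; apply: junk; first exact: measurable_funM.
move=> icg; apply: nig.
have := integrableZl measurableT c^-1 icg; apply: eq_integrable => // x _.
by rewrite /= -EFinM mulrA mulVf ?mul1r.
Qed.

Lemma normM_le_sqrD (R : realFieldType) (a b : R) : `|a * b| <= a ^+ 2 + b ^+ 2.
Proof.
rewrite normrM -[X in _ <= X + _]real_normK ?num_real // -[X in _ <= _ + X]real_normK ?num_real //.
have := sqr_ge0 (`|a| - `|b|); have := normr_ge0 a; have := normr_ge0 b; nra.
Qed.

Lemma integrable_sqr_mul d (T : measurableType d) (R : realType)
    (m : {measure set T -> \bar R}) (g k : T -> R) :
  measurable_fun setT g -> measurable_fun setT k ->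
  (\int[m]_x (g x ^+ 2)%:E < +oo)%E -> (\int[m]_x (k x ^+ 2)%:E < +oo)%E ->
  m.-integrable setT (EFin \o (fun x => g x * k x)).
Proof.
move=> mg mk g2 k2.
have mg2 : measurable_fun setT (fun x => (g x ^+ 2)%:E).
  by apply/measurable_EFinP; apply: measurable_funX.
have mk2 : measurable_fun setT (fun x => (k x ^+ 2)%:E).
  by apply/measurable_EFinP; apply: measurable_funX.
apply/integrableP; split; first by apply/measurable_EFinP; exact: measurable_funM.
apply: (@le_lt_trans _ _ (\int[m]_x ((g x ^+ 2)%:E + (k x ^+ 2)%:E))%E).
  apply: ge0_le_integral => //.
  - by apply/measurable_EFinP; apply: measurableT_comp => //; exact: measurable_funM.
  - exact: emeasurable_funD.
  - by move=> x _; rewrite -EFinD lee_fin; exact: normM_le_sqrD.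
rewrite ge0_integralD //; last 2 first.
- by move=> x _; rewrite lee_fin sqr_ge0.
- by move=> x _; rewrite lee_fin sqr_ge0.
by rewrite lte_add_pinfty.
Qed.

Lemma sqr_integrableB d (T : measurableType d) (R : realType)
    (m : {measure set T -> \bar R}) (g k : T -> R) :
  measurable_fun setT g -> measurable_fun setT k ->
  (\int[m]_x (g x ^+ 2)%:E < +oo)%E -> (\int[m]_x (k x ^+ 2)%:E < +oo)%E ->
  (\int[m]_x ((g x - k x) ^+ 2)%:E < +oo)%E.
Proof.
move=> mg mk g2 k2.
have int2 (l : T -> R) : measurable_fun setT l -> (\int[m]_x (l x ^+ 2)%:E < +oo)%E ->
    m.-integrable setT (EFin \o (fun x => l x * l x)).
  by move=> ml l2; exact: integrable_sqr_mul.
have iD := integrableD measurableT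
  (integrableD measurableT (int2 g mg g2) (int2 k mk k2))
  (integrableZl measurableT (- 2) (integrable_sqr_mul mg mk g2 k2)).
have [_] := integrableP _ _ _ iD; apply: le_lt_trans.
rewrite le_eqVlt; apply/orP; left; apply/eqP; apply: eq_integral => x _.
rewrite -[LHS]gee0_abs ?lee_fin ?sqr_ge0 //=; congr (`|_|%:E).
by ring.
Qed.

Lemma integrable_sqr d (T : measurableType d) (R : realType)
    (m : {measure set T -> \bar R}) (g : T -> R) :
  measurable_fun setT g -> (\int[m]_x (g x ^+ 2)%:E < +oo)%E ->
  m.-integrable setT (EFin \o (fun x => g x ^+ 2)).
Proof.
move=> mg g2; apply/integrableP; split.
  by apply/measurable_EFinP; exact: measurable_funX.
apply: le_lt_trans g2; rewrite le_eqVlt; apply/orP; left; apply/eqP.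
by apply: eq_integral => x _; rewrite /= ger0_norm ?sqr_ge0.
Qed.

Lemma integrable_Rintegral2 d1 d2 (T1 : measurableType d1) (T2 : measurableType d2)
    (R : realType) (m1 : {sigma_finite_measure set T1 -> \bar R})
    (m2 : {sigma_finite_measure set T2 -> \bar R}) (F : T1 * T2 -> R) :
  (m1 \x m2)%E.-integrable setT (EFin \o F) ->
  m2.-integrable setT (EFin \o (fun y => \int[m1]_x F (x, y))).
Proof.
move=> iF; have [mE _] := integrableP _ _ _ iF.
have mF : measurable_fun setT F by exact/measurable_EFinP.
apply/integrableP; split; first by apply/measurable_EFinP; exact: measurable_Rintegral.
apply: le_lt_trans (iffLR (integrable21ltyP _ _ mE) iF).
apply: ge0_le_integral => //.
- apply: measurableT_comp => //; apply/measurable_EFinP; exact: measurable_Rintegral.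
- apply: (@measurable_fun_fubini_tonelli_G _ _ _ _ _ m1 (fun z => `|(EFin \o F) z|%E)) => //.
  exact: measurableT_comp.
- move=> y _ /=.
  have my : measurable_fun setT (fun x => (F (x, y))%:E).
    by apply/measurable_EFinP; exact: measurableT_comp.
  apply: le_trans (le_abse_integral m1 measurableT my).
  by rewrite /Rintegral; case: (\int[m1]_x _)%E => [r||] //=; rewrite normr0 leey.
Qed.

(** * Affine changes of variable *)

(** The image measure, with its measurability proof as an argument so that it
    is a bundled measure. *)
Definition image_measure d1 d2 (T1 : measurableType d1) (T2 : measurableType d2)
    (R : realType) (m : {measure set T1 -> \bar R}) (phi : T1 -> T2)
    (mphi : measurable_fun setT phi) : {measure set T2 -> \bar R} :=
  measure_function_pushforward__canonical__measure_function_Measure m mphi.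
Arguments image_measure {d1 d2 T1 T2 R} m {phi} mphi.

Lemma affine_measurable (R : realType) (a b : R) :
  measurable_fun setT (fun x : R => a * x + b).
Proof. by apply: measurable_funD => //; apply: measurable_funM. Qed.

(** Both sides are measures in A, so intervals suffice. *)
Lemma lebesgue_affine (R : realType) (a b : R) (A : set R) : a != 0 ->
  measurable A ->
  (leb A = `|a|%:E * leb ((fun x => (a * x + b)%R) @^-1` A))%E.
Proof.
move=> a0 mA.
pose phi : measurableTypeR R -> measurableTypeR R := fun x => a * x + b.
have mphi : measurable_fun setT phi by exact: affine_measurable.
pose c : {nonneg R} := NngNum (normr_ge0 a).
pose nu : {measure set (measurableTypeR R) -> \bar R} :=
  mscale c (@image_measure _ _ _ _ R leb phi mphi).
suff -> : leb A = nu A by [].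
apply: lebesgue_measure_unique => //.
move=> _ [[x y] _ <-] /=.
rewrite /nu /mscale /= /pushforward -/phi.
case: (ltgtP a 0) => ha; last by rewrite ha eqxx in a0.
- have -> : phi @^-1` `]x, y] = [set` `[(y - b) / a, (x - b) / a[].
    apply/seteqP; split => z /=; rewrite !in_itv /= /phi ler_ndivrMr // ltr_ndivlMr //;
      by move=> /andP[? ?]; apply/andP; split; nra.
  rewrite !lebesgue_measure_itv /= !lte_fin ltr_nM2r ?invr_lt0 // ltrD2r.
  case: ifP => _; last by rewrite mule0.
  by rewrite -!EFinB -EFinM; congr EFin; rewrite ltr0_norm //; field.
have -> : phi @^-1` `]x, y] = [set` `](x - b) / a, (y - b) / a]].
  apply/seteqP; split => z /=; rewrite !in_itv /= /phi ler_pdivlMr // ltr_pdivrMr //;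
    by move=> /andP[? ?]; apply/andP; split; nra.
rewrite !lebesgue_measure_itv /= !lte_fin ltr_pM2r ?invr_gt0 // ltrD2r.
case: ifP => _; last by rewrite mule0.
by rewrite -!EFinB -EFinM; congr EFin; rewrite gtr0_norm //; field.
Qed.

Lemma ge0_integral_affine (R : realType) (a b : R) (g : R -> \bar R) :
  a != 0 -> measurable_fun setT g -> (forall x, 0 <= g x)%E ->
  (\int[leb]_x g x = `|a|%:E * \int[leb]_x g (a * x + b)%R)%E.
Proof.
move=> a0 mg g0.
pose phi : measurableTypeR R -> measurableTypeR R := fun x => a * x + b.
have mphi : measurable_fun setT phi by exact: affine_measurable.
pose c : {nonneg R} := NngNum (normr_ge0 a).
rewrite (eq_measure_integral (mscale c (@image_measure _ _ _ _ R leb phi mphi))); last first.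
  by move=> A mA _; exact: lebesgue_affine.
rewrite ge0_integral_mscale //.
by rewrite ge0_integral_pushforward.
Qed.

Lemma ge0_integral_affine_inv (R : realType) (a b : R) (g : R -> \bar R) :
  a != 0 -> measurable_fun setT g -> (forall x, 0 <= g x)%E ->
  (\int[leb]_x g (a * x + b)%R = `|a|^-1%:E * \int[leb]_x g x)%E.
Proof.
move=> a0 mg g0; rewrite (@ge0_integral_affine _ a b g) //.
by rewrite muleA -EFinM mulVf ?normr_eq0 // mul1e.
Qed.

Lemma integrable_affine (R : realType) (a b : R) (g : R -> R) :
  a != 0 -> leb.-integrable setT (EFin \o g) ->
  leb.-integrable setT (EFin \o (fun x => g (a * x + b))).
Proof.
move=> a0 /integrableP[mg ig].
have mga : measurable_fun setT (EFin \o g \o (fun x => a * x + b)).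
  by apply: measurableT_comp => //; exact: affine_measurable.
apply/integrableP; split => //.
have := @ge0_integral_affine_inv _ a b (fun x => `|(EFin \o g) x|%E) a0.
move=> -> //; last exact: measurableT_comp.
by rewrite lte_mul_pinfty.
Qed.

Lemma Rintegral_affine (R : realType) (a b : R) (g : R -> R) :
  a != 0 -> measurable_fun setT g ->
  \int[leb]_x g (a * x + b) = `|a|^-1 * \int[leb]_x g x.
Proof.
move=> a0 mg.
have mG : measurable_fun setT (EFin \o g) by exact/measurable_EFinP.
rewrite /Rintegral integralE [in RHS]integralE.
have Ep := @ge0_integral_affine_inv _ a b ((EFin \o g)^\+)%E a0.
have En := @ge0_integral_affine_inv _ a b ((EFin \o g)^\-)%E a0.
have c0 : 0 < `|a|^-1 by rewrite invr_gt0 normr_gt0.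
transitivity (fine ((`|a|^-1)%:E * \int[leb]_x (EFin \o g)^\+ x -
                    (`|a|^-1)%:E * \int[leb]_x (EFin \o g)^\- x)%E).
  congr (fine (_ - _)%E).
  - rewrite -Ep //; last exact: measurable_funepos.
    by apply: eq_integral => x _; rewrite !funeposE.
  - rewrite -En //; last exact: measurable_funeneg.
    by apply: eq_integral => x _; rewrite !funenegE.
set p := (\int[_]_x _)%E; set q := (\int[_]_x _)%E.
transitivity (`|a|^-1 * fine (p - q)%E); last by [].
clearbody p q; case: p => [p||]; case: q => [q||];
  rewrite /= ?gt0_muley ?gt0_muleNy ?lte_fin //= ?mulr0 ?mulrBr //.
Qed.

Lemma ge0_integral_translate (R : realType) (s : R) (g : R -> \bar R) :
  measurable_fun setT g -> (forall x, 0 <= g x)%E ->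
  (\int[leb]_x g (x - s)%R = \int[leb]_x g x)%E.
Proof.
move=> mg g0; have := @ge0_integral_affine_inv _ 1 (- s) g (oner_neq0 _) mg g0.
rewrite normr1 invr1 mul1e => <-; apply: eq_integral => x _.
by rewrite mul1r.
Qed.

Lemma measurable_translate (R : realType) d (T : measurableType d) (s : R) (g : R -> T) :
  measurable_fun setT g -> measurable_fun setT (fun x : R => g (x - s)).
Proof.
move=> mg; apply: measurableT_comp => //.
by apply: measurable_funB.
Qed.

Lemma Rintegral_translate (R : realType) (c : R) (g : R -> R) :
  measurable_fun setT g -> \int[leb]_x g (x + c) = \int[leb]_x g x.
Proof.
move=> mg; have := @Rintegral_affine _ 1 c g (oner_neq0 _) mg.
by rewrite normr1 invr1 mul1r => <-; apply: eq_Rintegral => x _; rewrite mul1r.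
Qed.

Lemma integrable_translate (R : realType) (c : R) (g : R -> R) :
  leb.-integrable setT (EFin \o g) ->
  leb.-integrable setT (EFin \o (fun x => g (x + c))).
Proof.
move=> ig; have := @integrable_affine _ 1 c g (oner_neq0 _) ig.
by apply: eq_integrable => // x _; rewrite /= mul1r.
Qed.

(** * Continuity of translations in mean square *)

(** Lets limits be split in the manner of an epsilon argument while the terms
    are extended real numbers. *)
Lemma ge0_cvge0P (R : realType) (u : nat -> \bar R) :
  (forall n, (0 <= u n)%E) ->
  u n @[n --> \oo] --> 0%E <->
  forall e : R, 0 < e -> \forall n \near \oo, (u n <= e%:E)%E.
Proof.
move=> u0; split => [/fine_cvgP[ufin /cvgrPdist_le uc] e e0|H].
- near=> n.
  have un : u n \is a fin_num by near: n.
  rewrite -(fineK un) lee_fin; apply: le_trans (ler_norm _) _.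
  rewrite -normrN -[- _]add0r; near: n; exact: uc.
- apply/fine_cvgP; split.
  + apply: filterS (H _ ltr01) => n un.
    by rewrite ge0_fin_numE // (le_lt_trans un) // ltry.
  + apply/cvgrPdist_le => e e0; apply: filterS (H _ e0) => n un.
    rewrite sub0r normrN ger0_norm ?fine_ge0 //.
    rewrite -lee_fin fineK // ge0_fin_numE //; exact: le_lt_trans un (ltry _).
Unshelve. all: by end_near. Qed.

(** Cutting off far out costs little by dominated convergence; on the bounded
    interval that remains, continuous functions are dense. *)
Lemma L1_approximation (R : realType) (G : R -> R) (e : R) :
  leb.-integrable setT (EFin \o G) -> 0 < e ->
  exists (c : R -> R) (N : R), [/\ continuous c, 0 < N &
    (\int[leb]_x `|G x - c x * \1_(`[- N, N]) x|%:E <= e%:E)%E].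
Proof.
move=> iG e0.
pose G_ (n : nat) x := (G x * \1_(`[- n%:R, n%:R]%classic) x)%:E.
have mG : measurable_fun setT G by case/integrableP : iG => /measurable_EFinP.
have mI (N : R) : measurable_fun setT (\1_(`[- N, N]%classic) : R -> R) by [].
have H1 : {ae leb, forall x, setT x -> G_ ^~ x @ \oo --> (EFin \o G) x}.
  apply: aeW => x _; apply: cvg_near_cst.
  near=> n; rewrite /G_ /= indicE mem_set ?mulr1 //=.
  rewrite in_itv /= -ler_norml; near: n; exact: nbhs_infty_ger.
have H2 : {ae leb, forall x n, setT x -> (`|G_ n x| <= `|G x|%:E)%E}.
  apply: aeW => x n _; rewrite /G_ /= lee_fin normrM ler_piMr //.
  by rewrite indicE; case: (_ \in _); rewrite ?normr1 ?normr0.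
have mG_ n : measurable_fun setT (G_ n).
  by apply/measurable_EFinP; exact: measurable_funM.
have mG' : measurable_fun setT (EFin \o G) by exact/measurable_EFinP.
have [_ + _] :=
  @dominated_convergence _ _ _ leb setT measurableT G_ (EFin \o G) _ mG_ mG' H1 (integrable_abse iG) H2.
move=> /ge0_cvge0P -/(_ _ (e / 2)) [].
- by move=> n; exact: integral_ge0.
- by rewrite divr_gt0.
move=> n0 _ Hn.
pose n := n0.+1.
have Gn : (\int[leb]_x `|G x - G x * \1_`[- n%:R, n%:R]%classic x|%:E <= (e / 2)%:E)%E.
  apply: le_trans (Hn n (leqnSn _)); rewrite le_eqVlt; apply/orP; left; apply/eqP.
  by apply: eq_integral => x _; rewrite /G_ /= distrC.
pose E : set R := `[- n%:R, n%:R]%classic.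
have mE : measurable E by rewrite /E; exact: measurable_itv.
have muE : (leb E < +oo)%E.
  by rewrite /E lebesgue_measure_itv /=; case: ifP => _; rewrite ltry.
have iE : leb.-integrable E (EFin \o G) by apply: integrableS iG.
have [g [cg ig]] := @approximation_continuous_integrable R E G mE muE iE.
move=> /ge0_cvge0P -/(_ _ (e / 2)) [].
- by move=> k; exact: integral_ge0.
- by rewrite divr_gt0.
move=> k _ /(_ k (leqnn k)) Gk.
exists (g k), n%:R; split => //.
have mg : measurable_fun setT (g k) by exact: continuous_measurable_fun.
apply: (@le_trans _ _ (\int[leb]_x (`|G x - G x * \1_`[- n%:R, n%:R]%classic x|%:E +
   `|G x - g k x|%:E * (\1_`[- n%:R, n%:R]%classic x)%:E))%E).
  apply: ge0_le_integral => //.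
  - apply/measurable_EFinP; apply: measurableT_comp => //.
    by apply: measurable_funB => //; exact: measurable_funM.
  - apply: emeasurable_funD.
      apply/measurable_EFinP; apply: measurableT_comp => //.
      by apply: measurable_funB => //; exact: measurable_funM.
    by apply: emeasurable_funM; apply/measurable_EFinP => //;
      apply: measurableT_comp => //; exact: measurable_funB.
  - move=> x _; rewrite -EFinM -EFinD lee_fin.
    rewrite indicE; case: (_ \in _); rewrite ?mulr1 ?mulr0 ?addr0 //.
    by rewrite subrr normr0 add0r.
rewrite ge0_integralD //; last 2 first.
- apply/measurable_EFinP; apply: measurableT_comp => //.
  by apply: measurable_funB => //; exact: measurable_funM.
- by apply: emeasurable_funM; apply/measurable_EFinP => //;
    apply: measurableT_comp => //; exact: measurable_funB.
rewrite [e in leRHS]splitr EFinD; apply: leeD => //.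
by apply: le_trans Gk; rewrite [leRHS]integral_mkcond epatch_indic.
Unshelve. all: by end_near. Qed.

(** For the approximations of the previous lemma this is dominated convergence,
    the two end points being negligible; the error of the approximation is
    counted twice because Lebesgue measure is translation invariant. *)
Lemma L1_translation_cvg (R : realType) (G : R -> R) (s : nat -> R) :
  leb.-integrable setT (EFin \o G) -> s n @[n --> \oo] --> 0 ->
  (\int[leb]_x `|G (x - s n) - G x|%:E)%E @[n --> \oo] --> 0%E.
Proof.
move=> iG s0.
have mG : measurable_fun setT G by case/integrableP : iG => /measurable_EFinP.
apply/ge0_cvge0P => [n|e e0]; first exact: integral_ge0.
have [c [N [cc N0 Gc]]] := @L1_approximation _ G (e / 3) iG (divr_gt0 e0 (ltr0Sn _ 2)).
have mc : measurable_fun setT c by exact: continuous_measurable_fun.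
pose G' x := c x * \1_(`[- N, N]%classic) x.
have mG' : measurable_fun setT G' by apply: measurable_funM.
have [B B0 sB] : exists2 B, 0 < B & forall n, `|s n| <= B.
  have /cvg_seq_bounded [B [_ sB]] : cvgn s by apply/cvg_ex; exists 0.
  exists (`|B| + 1); first by rewrite ltr_wpDl.
  by move=> n; apply: sB => //; rewrite (le_lt_trans (ler_norm _)) // ltrDl.
have [M M0 cM] : exists2 M, 0 < M & forall x, `|G' x| <= M.
  have /compact_bounded [M [_ cM]] : compact (c @` `[- N, N]%classic).
    apply: continuous_compact; last exact: segment_compact.
    exact: continuous_subspaceT.
  exists (`|M| + 1); first by rewrite ltr_wpDl.
  move=> x; rewrite /G' indicE; case: (boolP (x \in _)) => [|_]; last first.
    by rewrite mulr0 normr0 addr_ge0.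
  rewrite inE mulr1 => xN; apply: (cM (`|M| + 1)); last by exists x.
  by rewrite (le_lt_trans (ler_norm _)) // ltrDl.
have cv' : (\int[leb]_x `|G' (x - s n) - G' x|%:E)%E @[n --> \oo] --> 0%E.
  pose D x := (2 * M * \1_(`[- (N + B), N + B]%classic) x)%:E.
  pose F n x := `|G' (x - s n) - G' x|%:E.
  have mF n : measurable_fun setT (F n).
    apply/measurable_EFinP; apply: measurableT_comp => //.
    by apply: measurable_funB => //; exact: measurable_translate.
  have iD : leb.-integrable setT D.
    apply: (@integrableZl _ _ _ leb setT measurableT (2 * M)
      (EFin \o \1_(`[- (N + B), N + B]%classic))).
    exact: integrable_indic_itv.
  have H1 : {ae leb, forall x, setT x -> F ^~ x @ \oo --> (cst 0%E : R -> \bar R) x}.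
    exists [set - N; N]; split.
    - exact: measurableU.
    - apply: countable_lebesgue_measure0; apply: finite_set_countable.
      by rewrite finite_setU; split; exact: finite_set1.
    - move=> x /=; apply: contra_notP => xN _.
      rewrite /F /cst; apply/fine_cvgP; split; first by apply: nearW.
      (* Inside the interval the continuity of c applies; outside, both terms vanish
         for large n. *)
      have [xlt|xge] := ltP `|x| N.
      + have cG : G' (x - s n) @[n --> \oo] --> G' x.
          rewrite /G' [X in _ --> c x * X](_ : _ = 1); last first.
            by rewrite indicE mem_set //= in_itv /= -ler_norml ltW.
          apply: cvgM; first last.
            apply: cvg_near_cst.
            have d0 : 0 < N - `|x| by rewrite subr_gt0.
            have /cvgrPdist_lt /(_ _ d0) := s0; apply: filterS => n.
            rewrite sub0r normrN => sn; rewrite indicE mem_set //= in_itv /= -ler_norml.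
            by rewrite (le_trans (ler_normB _ _)) // -lerBrDl ltW.
          apply: (@cvg_comp _ _ _ (fun n => x - s n) c _ (nbhs x)) => //; last exact: cc.
          have : x - s n @[n --> \oo] --> x - 0 by apply: cvgB => //; exact: cvg_cst.
          by rewrite subr0.
        rewrite -(normr0 R) -(subrr (G' x)); apply: cvg_norm.
        by apply: cvgB => //; exact: cvg_cst.
      + have {}xge : N < `|x|.
          rewrite lt_neqAle xge andbT; apply: contra_notN xN => /eqP Nx.
          by have [x0|x0] := ltP x 0; [left|right]; move: Nx;
             [rewrite ltr0_norm // => ->; rewrite opprK | rewrite ger0_norm].
        apply: cvg_near_cst.
        have d0 : 0 < `|x| - N by rewrite subr_gt0.
        have /cvgrPdist_lt /(_ _ d0) := s0; apply: filterS => n.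
        rewrite sub0r normrN => sn /=.
        rewrite /G' !indicE !memNset /= ?mulr0 ?subrr ?normr0 //.
        * by rewrite in_itv /= -ler_norml; apply/negP; rewrite -ltNge.
        * rewrite in_itv /= -ler_norml; apply/negP; rewrite -ltNge.
          rewrite (lt_le_trans _ (lerB_dist _ _)) //; lra.
  have H2 : {ae leb, forall x n, setT x -> (`|F n x| <= D x)%E}.
    apply: aeW => x n _; rewrite /F /D /= lee_fin normr_id.
    rewrite indicE; case: (boolP (x \in _)) => [_|/negP].
      rewrite mulr1 (le_trans (ler_normB _ _)) // mulr2n mulrDl mul1r lerD //.
    rewrite inE /= in_itv /= -ler_norml => xNB.
    rewrite /G' !indicE !memNset /= ?mulr0 ?subrr ?normr0 //.
    + rewrite in_itv /= -ler_norml; move=> xN; apply: xNB.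
      by rewrite (le_trans xN) // lerDl ltW.
    + rewrite in_itv /= -ler_norml; move=> xN; apply: xNB.
      rewrite -(subrK (s n) x) (le_trans (ler_normD _ _)) // lerD //.
  have [_ _] :=
    @dominated_convergence _ _ _ leb setT measurableT F (cst 0%E) D mF (measurable_cst _) H1 iD H2.
  by rewrite integral0.
have e30 : 0 < e / 3 by rewrite divr_gt0.
move/ge0_cvge0P : cv' => /(_ _ _ e30) []; first by move=> n; exact: integral_ge0.
move=> n0 ? cv'; exists n0 => // n /cv' {}cv'.
pose H x := `|G x - G' x|%:E.
have mH : measurable_fun setT H.
  by apply/measurable_EFinP; apply: measurableT_comp => //; exact: measurable_funB.
have H0 x : (0 <= H x)%E by rewrite lee_fin.
have mHs : measurable_fun setT (fun x : R => H (x - s n)) by exact: measurable_translate.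
have mF : measurable_fun setT (fun x : R => `|G' (x - s n) - G' x|%:E).
  apply/measurable_EFinP; apply: measurableT_comp => //.
  by apply: measurable_funB => //; exact: measurable_translate.
apply: (@le_trans _ _ (\int[leb]_x (H (x - s n)%R + `|G' (x - s n) - G' x|%:E + H x))%E).
  apply: ge0_le_integral => //.
  - apply/measurable_EFinP; apply: measurableT_comp => //.
    by apply: measurable_funB => //; exact: measurable_translate.
  - by apply: emeasurable_funD => //; exact: emeasurable_funD.
  - move=> x _; rewrite -!EFinD lee_fin (distrC (G x) (G' x)).
    apply: le_trans (_ : `|(G (x - s n) - G' (x - s n)) + (G' (x - s n) - G' x)| + `|G' x - G x| <= _).
      by apply: le_trans (ler_normD _ _); rewrite le_eqVlt; apply/orP; left; apply/eqP; congr (`|_|); ring.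
    by rewrite lerD2r ler_normD.
rewrite ge0_integralD //; try exact: emeasurable_funD; try by move=> x _; rewrite adde_ge0 ?lee_fin.
rewrite ge0_integralD //.
have Hs : (\int[leb]_x H (x - s n)%R <= (e / 3)%:E)%E.
  rewrite (@ge0_integral_translate _ (s n) H mH) //.
have -> : e = e / 3 + e / 3 + e / 3 by field.
by rewrite !EFinD; apply: leeD => //; apply: leeD.
Qed.

(** Reduces mean square statements about g to mean statements about g |g|. *)
Lemma sqr_diff_le_signed_sqr (R : realFieldType) (a b : R) :
  (a - b) ^+ 2 <= 2 * `|a * `|a| - b * `|b| |.
Proof.
have key (x y : R) : y <= x -> (x - y) ^+ 2 <= 2 * (x * `|x| - y * `|y|).
  move=> yx; have d0 : 0 <= x - y by rewrite subr_ge0.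
  case: (ger0P x) => x0; case: (ger0P y) => y0.
  - have := mulr_ge0 d0 x0; have := mulr_ge0 d0 y0; nra.
  - have := sqr_ge0 (x + y); nra.
  - by have := le_lt_trans (le_trans y0 yx) x0; rewrite ltxx.
  - have nx : 0 <= - x by rewrite oppr_ge0 ltW.
    have ny : 0 <= - y by rewrite oppr_ge0 ltW.
    have := mulr_ge0 d0 nx; have := mulr_ge0 d0 ny; nra.
case: (lerP b a) => ab.
  by apply: le_trans (key _ _ ab) _; rewrite ler_wpM2l // ler_norm.
rewrite -sqrrN opprB distrC.
by apply: le_trans (key _ _ (ltW ab)) _; rewrite ler_wpM2l // ler_norm.
Qed.

Lemma L2_translation_cvg (R : realType) (g : R -> R) (s : nat -> R) :
  measurable_fun setT g -> (\int[leb]_x (g x ^+ 2)%:E < +oo)%E ->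
  s n @[n --> \oo] --> 0 ->
  (\int[leb]_x ((g (x - s n) - g x) ^+ 2)%:E)%E @[n --> \oo] --> 0%E.
Proof.
move=> mg g2 s0.
pose G x := g x * `|g x|.
have mG : measurable_fun setT G by apply: measurable_funM => //; exact: measurableT_comp.
have iG : leb.-integrable setT (EFin \o G).
  apply/integrableP; split; first exact/measurable_EFinP.
  apply: le_lt_trans g2; rewrite le_eqVlt; apply/orP; left; apply/eqP.
  by apply: eq_integral => x _; rewrite /= /G normrM normr_id -expr2 real_normK ?num_real.
have mD n : measurable_fun setT (fun x : R => `|G (x - s n) - G x|%:E).
  apply/measurable_EFinP; apply: measurableT_comp => //.
  by apply: measurable_funB => //; exact: measurable_translate.
have /ge0_cvge0P L1 := @L1_translation_cvg _ G s iG s0.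
apply/ge0_cvge0P => [n|e e0].
  by apply: integral_ge0 => x _; rewrite lee_fin sqr_ge0.
have e20 : 0 < e / 2 by rewrite divr_gt0.
have L0 n : (0 <= \int[leb]_x `|G (x - s n) - G x|%:E)%E by exact: integral_ge0.
apply: filterS (L1 L0 _ e20) => n Hn.
apply: (@le_trans _ _ (\int[leb]_x (2%:E * `|G (x - s n) - G x|%:E))%E).
  apply: ge0_le_integral => //.
  - by move=> x _; rewrite lee_fin sqr_ge0.
  - apply/measurable_EFinP; apply: measurable_funX.
    by apply: measurable_funB => //; exact: measurable_translate.
  - by apply: emeasurable_funM => //; exact: mD.
  - by move=> x _; rewrite -EFinM lee_fin sqr_diff_le_signed_sqr.
rewrite ge0_integralZl //; try exact: mD; try by rewrite lee_fin.
have -> : e = 2 * (e / 2) by field.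
rewrite EFinM; apply: lee_wpmul2l => //; by rewrite lee_fin.
Qed.

(** * Smooth bumps and the fundamental lemma of the calculus of variations *)

(** The powers of 1/y make the family stable under differentiation, up to
    linear combinations. *)
Definition flat (R : realType) (m : nat) (y : R) : R :=
  if 0 < y then y^-1 ^+ m * expR (- y^-1) else 0.
Arguments flat {R}.

Lemma flat_ge0 (R : realType) m (y : R) : 0 <= flat m y.
Proof.
rewrite /flat; case: ltP => // y0.
by rewrite mulr_ge0 ?exprn_ge0 ?expR_ge0 // invr_ge0 ltW.
Qed.

(** With z = 1/y, this is z^m / m! <= exp z. *)
Lemma flat_le (R : realType) m (y : R) : flat m y <= m`!%:R.
Proof.
rewrite /flat; case: ltP => // y0.
have z0 : 0 <= y^-1 by rewrite invr_ge0 ltW.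
rewrite expRN ler_pdivrMr ?expR_gt0 //.
case: m => [|m]; first by rewrite expr0 mul1r -expR0 ler_expR.
have := @expR_ge1Dxn _ y^-1 m z0.
have f0 : (0 : R) < (m.+1)`!%:R by rewrite ltr0n fact_gt0.
move=> H; rewrite mulrC -ler_pdivrMr //; apply: le_trans H.
by rewrite lerDr.
Qed.

Lemma flatS (R : realType) m (y : R) : flat m.+1 y = y^-1 * flat m y.
Proof. by rewrite /flat; case: ifP => _; rewrite ?mulr0 // exprS mulrA. Qed.

(** At the origin the difference quotient of [flat m] is [flat m.+1], that is,
    y times the bounded function [flat m.+2]. *)
Lemma is_derive_flat (R : realType) m (y : R) :
  is_derive y 1 (flat m) (flat m.+2 y - m%:R * flat m.+1 y).
Proof.
have [y0|y0|->] := ltgtP y 0.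
- rewrite /flat ltNge (ltW y0) /= mulr0 subrr.
  apply: (@near_eq_is_derive _ _ _ (cst 0)) => //.
  + near=> z; rewrite /cst ltNge; suff -> : z <= 0 by [].
    by apply/ltW; near: z; exact: lt_nbhsl.
- rewrite /flat y0.
  apply: (@near_eq_is_derive _ _ _ (fun z : R => z^-1 ^+ m * expR (- z^-1))).
  + near=> z; suff -> : 0 < z by [].
    by near: z; exact: lt_nbhsr.
  + have yn0 : id y != 0 :> R by rewrite gt_eqF.
    have dV := is_deriveV yn0 (is_derive_id y 1).
    have dX := is_deriveX m dV; rewrite exprfctE in dX.
    have dN : is_derive y 1 (fun z : R => - z^-1) _ := is_deriveN dV.
    have dE := @is_derive1_comp _ expR (fun z => - z^-1) y _ _ (is_derive_expR _) dN.
    have := is_deriveM dX dE; move=> /is_derive_eq; apply.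
    rewrite /= /GRing.scale /= !exprSr.
    case: m {dX} => [|m] /=; rewrite ?expr0 ?exprSr; field; exact: yn0.
- have -> : flat m.+2 0 - m%:R * flat m.+1 0 = 0 :> R by rewrite /flat ltxx mulr0 subr0.
  have cv : h^-1 *: ((flat m \o shift 0) (h *: 1) - flat m 0) @[h --> (0:R)^'] --> (0 : R).
    apply/cvgrPdist_le => e e0.
    have C0 : (0 : R) < (m.+2)`!%:R by rewrite ltr0n fact_gt0.
    near=> h.
    rewrite sub0r normrN /= /shift addr0 /GRing.scale /= mulr1.
    rewrite [flat m 0]/flat ltxx subr0 -flatS ger0_norm ?flat_ge0 //.
    have [h0|h0] := leP h 0; first by rewrite /flat ltNge h0 ltW.
    have -> : flat m.+1 h = h * flat m.+2 h by rewrite [in RHS]flatS mulrA divff ?gt_eqF // mul1r.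
    apply: (@le_trans _ _ (h * (m.+2)`!%:R)).
      by rewrite ler_pM2l // flat_le.
    rewrite -ler_pdivlMr // -(gtr0_norm h0).
    near: h; apply: nbhs_dnbhs; apply/nbhs_ballP; exists (e / (m.+2)`!%:R) => /=.
      by rewrite divr_gt0.
    by move=> h /=; rewrite /ball /= sub0r normrN => /ltW.
  apply: DeriveDef; last by apply/cvg_lim.
  by apply/cvg_ex; exists 0.
Unshelve. all: by end_near. Qed.

(** Boundedness of all the derivatives up to order n is carried along, since
    it is what makes products with integrable functions integrable. *)
Fixpoint bounded_smooth {R : realType} (n : nat) (f : R -> R) : Prop :=
  (exists M, forall x, `|f x| <= M) /\
  (if n is n'.+1 then
     exists2 f' : R -> R, (forall x : R, is_derive x 1 f (f' x)) & bounded_smooth n' f'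
   else True).

Section bounded_smooth_theory.
Context {R : realType}.
Implicit Types f g : R -> R.

Lemma bounded_smooth_bounded n f : bounded_smooth n f -> exists M, forall x, `|f x| <= M.
Proof. by case: n => [|n] []. Qed.

Lemma bounded_smoothW n f : bounded_smooth n.+1 f -> bounded_smooth n f.
Proof.
elim: n f => [|n IH] f [bf] [f' df' sf']; split => //.
by exists f' => //; exact: IH.
Qed.

Lemma bounded_smoothD n f g :
  bounded_smooth n f -> bounded_smooth n g -> bounded_smooth n (f \+ g).
Proof.
elim: n f g => [|n IH] f g [[A fA] Sf] [[B gB] Sg]; split => //.
- by exists (A + B) => x; rewrite (le_trans (ler_normD _ _)) ?lerD.
- by exists (A + B) => x; rewrite (le_trans (ler_normD _ _)) ?lerD.
- case: Sf => f' df sf; case: Sg => g' dg sg; exists (f' \+ g'); last exact: IH.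
  by move=> x; exact: is_deriveD.
Qed.

Lemma bounded_smoothM n f g :
  bounded_smooth n f -> bounded_smooth n g -> bounded_smooth n (f \* g).
Proof.
elim: n f g => [|n IH] f g.
  move=> [[A fA] _] [[B gB] _]; split => //.
  by exists (A * B) => x; rewrite /= normrM ler_pM.
move=> Sf Sg; have Sf' := bounded_smoothW Sf; have Sg' := bounded_smoothW Sg.
case: Sf => [[A fA] [f' df sf]]; case: Sg => [[B gB] [g' dg sg]]; split.
  by exists (A * B) => x; rewrite /= normrM ler_pM.
exists ((f \* g') \+ (g \* f')); last by apply: bounded_smoothD; exact: IH.
by move=> x; exact: is_deriveM.
Qed.

Lemma bounded_smooth_cst n (c : R) : bounded_smooth n (cst c).
Proof.
elim: n c => [|n IH] c; split => //; try by exists `|c|.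
by exists (cst 0) => // x; exact: is_derive_cst.
Qed.

Lemma bounded_smooth_affine n f (a b : R) :
  bounded_smooth n f -> bounded_smooth n (fun x => f (a * x + b)).
Proof.
elim: n f => [|n IH] f [[A fA] Sf]; split => //; try by exists A.
case: Sf => f' df sf; exists (cst a \* (fun x => f' (a * x + b))).
  move=> x.
  have dab : is_derive x 1 (fun x : R => a * x + b) a.
    have := is_deriveD (is_deriveZ a (is_derive_id x 1)) (is_derive_cst b x 1).
    by move=> /is_derive_eq; apply; rewrite /GRing.scale /= mulr1 addr0.
  have := @is_derive1_comp _ f (fun x => a * x + b) x _ _ (df (a * x + b)) dab.
  by move=> /is_derive_eq; apply; rewrite /= mulrC.
by apply: bounded_smoothM; [exact: bounded_smooth_cst|exact: IH].
Qed.

Lemma bounded_smooth_flat n m : bounded_smooth n (flat m : R -> R).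
Proof.
elim: n m => [|n IH] m; split => //.
- by exists m`!%:R => x; rewrite ger0_norm ?flat_ge0 // flat_le.
- by exists m`!%:R => x; rewrite ger0_norm ?flat_ge0 // flat_le.
- exists (flat m.+2 \+ (cst (- m%:R) \* flat m.+1)).
    move=> x; apply: is_derive_eq (is_derive_flat m x) _.
    by rewrite /= mulNr.
  apply: bounded_smoothD; first exact: IH.
  by apply: bounded_smoothM; [exact: bounded_smooth_cst|exact: IH].
Qed.

Lemma bounded_smooth_derive1n (k n : nat) f :
  bounded_smooth (k + n) f -> bounded_smooth n (f^`(k))%classic.
Proof.
elim: k n => [|k IH] n // Sf; rewrite derive1nS.
have : bounded_smooth n.+1 (f^`(k))%classic by apply: IH; rewrite addnS.
move=> [_ [g dg sg]].
suff -> : ((f^`(k))^`())%classic = g by [].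
by apply/funext => x; rewrite derive1E; exact: derive_val.
Qed.

Lemma bounded_smooth_derivable n f (x : R) : bounded_smooth n.+1 f -> derivable f x 1.
Proof. by move=> [_ [g dg _]]; exact: ex_derive. Qed.

End bounded_smooth_theory.

(** Written with affine arguments a * x + b so that [bounded_smooth_affine]
    applies as it stands. *)
Definition smooth_bump (R : realType) (n : nat) (a b x : R) : R :=
  flat 0 (n.+1%:R * x + - (n.+1%:R * a)) * flat 0 (- n.+1%:R * x + n.+1%:R * b).

Section bump_theory.
Context {R : realType}.
Implicit Types (a b x s : R).

Lemma bumpE n a b x :
  smooth_bump n a b x = flat 0 (n.+1%:R * (x - a)) * flat 0 (n.+1%:R * (b - x)).
Proof. by rewrite /smooth_bump; congr (flat 0 _ * flat 0 _); ring. Qed.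

Lemma bump_ge0 n a b x : 0 <= smooth_bump n a b x.
Proof. by rewrite mulr_ge0 ?flat_ge0. Qed.

Lemma bump_le1 n a b x : smooth_bump n a b x <= 1.
Proof. by rewrite -[leRHS]mulr1 ler_pM ?flat_ge0 // flat_le. Qed.

Lemma bump_out n a b x : x \notin `]a, b[ -> smooth_bump n a b x = 0.
Proof.
have n0 : (0 : R) < n.+1%:R by rewrite ltr0n.
rewrite in_itv /= negb_and -!leNgt bumpE /flat.
rewrite !pmulr_rgt0 // !subr_gt0 => /orP[xa|bx].
  by rewrite ltNge xa mul0r.
by rewrite [x < b]ltNge bx mulr0.
Qed.

Lemma bump_le_indic n a b x : smooth_bump n a b x <= \1_(`]a, b[%classic : set R) x.
Proof.
rewrite indicE; case: (boolP (x \in _)) => xab; first exact: bump_le1.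
by rewrite bump_out //; apply: contra xab => xab; exact/mem_set.
Qed.

Lemma bump_translate n a b s x : smooth_bump n a b (x + s) = smooth_bump n (a - s) (b - s) x.
Proof. by rewrite /smooth_bump; congr (flat 0 _ * flat 0 _); ring. Qed.

(** On the interval each factor is exp (- 1 / ((n + 1) c)) for some c > 0. *)
Lemma bump_cvg a b x : smooth_bump n a b x @[n --> \oo] --> (\1_(`]a, b[%classic) x : R).
Proof.
rewrite indicE; have [|xab] := boolP (x \in `]a, b[%classic); last first.
  apply: cvg_near_cst; apply: nearW => n; apply: bump_out.
  by apply: contra xab => xab; exact/mem_set.
rewrite inE /= in_itv /= => /andP[ax xb].
have key (c : R) : 0 < c -> flat 0 (n.+1%:R * c) @[n --> \oo] --> (1 : R).
  move=> c0.
  have -> : (fun n => flat 0 (n.+1%:R * c)) = (fun n => expR (- (c^-1 * n.+1%:R^-1))) :> (nat -> R).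
    by apply/funext => n; rewrite /flat mulr_gt0 // expr0 mul1r invfM mulrC.
  have H : - (c^-1 * n.+1%:R^-1) @[n --> \oo] --> (0 : R).
    rewrite -oppr0 -(mulr0 c^-1); apply: cvgN; apply: cvgM; first exact: cvg_cst.
    exact: cvg_harmonic.
  by have := cvg_comp _ _ H (@continuous_expR R 0); rewrite expR0; exact.
under eq_fun do rewrite bumpE.
have xa0 : 0 < x - a by rewrite subr_gt0.
have bx0 : 0 < b - x by rewrite subr_gt0.
by have := cvgM (key _ xa0) (key _ bx0); rewrite mulr1; exact.
Qed.

Lemma bounded_smooth_bump k n a b : bounded_smooth k (smooth_bump n a b).
Proof.
apply: (@bounded_smoothM _ k (fun x => flat 0 (n.+1%:R * x + - (n.+1%:R * a)))
  (fun x => flat 0 (- n.+1%:R * x + n.+1%:R * b)));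
  by apply: bounded_smooth_affine; exact: bounded_smooth_flat.
Qed.

Lemma test_function_bump n a b : test_function (smooth_bump n a b).
Proof.
split.
  move=> k x; apply: (@bounded_smooth_derivable _ 0); apply: bounded_smooth_derive1n.
  exact: bounded_smooth_bump.
apply: (@subclosed_compact _ _ `[a, b]%classic).
- exact: closed_closure.
- exact: segment_compact.
- have /closure_id -> : closed (`[a, b]%classic : set R) by exact: itv_closed.
  apply: closure_subset => x /= xn0; apply: contraNT xn0 => xab.
  apply/eqP/bump_out; apply: contra xab; rewrite !in_itv /= => /andP[/ltW -> /ltW ->].
  by [].
Qed.

Lemma measurable_bump n a b : measurable_fun setT (smooth_bump n a b).
Proof.
apply: continuous_measurable_fun => x.
apply: differentiable_continuous; apply/derivable1_diffP.
exact: (@bounded_smooth_derivable _ 0 _ x (bounded_smooth_bump 1 n a b)).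
Qed.

Lemma integrable_segment (g : R -> R) a b :
  locally_integrable setT g -> lebesgue_measure.-integrable `[a, b] (EFin \o g).
Proof.
move=> [mg _ ig]; apply/integrableP; split.
  by apply/measurable_EFinP; exact: measurable_funTS.
by apply: ig => //; exact: segment_compact.
Qed.

(** Dominated convergence along the bumps that increase to the indicator of
    the interval. *)
Lemma integral_bump_eq0 (g : R -> R) a b :
  locally_integrable setT g ->
  (forall n, \int[lebesgue_measure]_x (g x * smooth_bump n a b x) = 0) ->
  \int[lebesgue_measure]_(x in `]a, b[) g x = 0.
Proof.
move=> lg H; have [mg _ _] := lg.
pose gab x := g x * \1_(`]a, b[%classic : set R) x.
have iab : lebesgue_measure.-integrable setT
    (EFin \o gab).
  have : lebesgue_measure.-integrable (`]a, b[%classic : set R) (EFin \o g).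
    apply: integrableS (integrable_segment a b lg) => //.
    exact: subset_itv_oo_cc.
  by move=> /integrable_mkcond; rewrite epatch_indic; apply.
pose F n x := (g x * smooth_bump n a b x)%:E.
have mF n : measurable_fun setT (F n).
  by apply/measurable_EFinP; apply: measurable_funM => //; exact: measurable_bump.
have mf : measurable_fun setT (EFin \o gab).
  by case/integrableP : iab.
have H1 : {ae lebesgue_measure, forall x, setT x -> F ^~ x @ \oo -->
    (EFin \o gab) x}.
  apply: aeW => x _; apply/fine_cvgP; split; first by apply: nearW.
  by apply: cvgM; [exact: cvg_cst|exact: bump_cvg].
have H2 : {ae lebesgue_measure, forall x n, setT x -> (`|F n x| <=
    `|(EFin \o gab) x|)%E}.
  apply: aeW => x n _; rewrite /F /gab /= lee_fin !(normrM (g x)) ler_wpM2l //.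
  rewrite (ger0_norm (bump_ge0 _ _ _ _)).
  exact: le_trans (bump_le_indic _ _ _ _) (ler_norm _).
have [_ _] := @dominated_convergence _ _ _ lebesgue_measure setT measurableT F
  (EFin \o gab) _ mF mf H1 (integrable_abse iab) H2.
have F0 n : (\int[lebesgue_measure]_x F n x = 0)%E.
  have Hn : fine (\int[lebesgue_measure]_x F n x)%E = 0 := H n.
  rewrite -(@fineK _ (\int[lebesgue_measure]_x F n x)%E) ?Hn //.
  apply: integrable_fin_num => //; apply/integrableP; split; first exact: mF.
  case/integrableP : iab => _; apply: le_lt_trans.
  apply: ge0_le_integral => //; [|exact: measurableT_comp|].
    by apply: measurableT_comp => //; exact: mF.
  move=> x _; rewrite /F /gab /= lee_fin !(normrM (g x)) ler_wpM2l //.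
  rewrite (ger0_norm (bump_ge0 _ _ _ _)).
  exact: le_trans (bump_le_indic _ _ _ _) (ler_norm _).
move=> cvF.
rewrite /Rintegral integral_mkcond.
suff -> : (\int[lebesgue_measure]_x ((fun x => (g x)%:E) \_ `]a, b[%classic) x = 0)%E by [].
transitivity (\int[lebesgue_measure]_x (EFin \o gab) x)%E.
  by rewrite epatch_indic.
have E0 : (fun n => \int[lebesgue_measure]_x F n x)%E = cst 0%E by apply/funext => n; exact: F0.
rewrite -(cvg_lim (@ereal_hausdorff R) cvF) /= E0.
by apply: lim_cst.
Qed.

(** All integrals over intervals vanish, and almost everywhere g is the
    derivative of its integral. *)
Lemma bump_orthogonal_ae0 (g : R -> R) :
  locally_integrable setT g ->
  (forall n a b, \int[lebesgue_measure]_x (g x * smooth_bump n a b x) = 0) ->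
  {ae lebesgue_measure, forall x, g x = 0}.
Proof.
move=> lg H.
have key (N : nat) : {ae lebesgue_measure, forall x, - N%:R < x -> g x = 0}.
  have iN (y : R) : lebesgue_measure.-integrable
      [set` Interval (BLeft (- N%:R)) (BRight y)] (EFin \o g).
    exact: integrable_segment.
  (* A primitive needs a finite base point; those at the points - N cover the
     line. *)
  apply: (@filterS _ _ (ae_filter_ringOfSetsType lebesgue_measure) _ _ _ (FTC1 iN lg)).
  move=> x + Nx => -[|_ <-]; first by rewrite /= lte_fin.
  have -> : (fun x : R => \int[lebesgue_measure]_(t in
      [set` Interval (BLeft (- N%:R)) (BRight x)]) g t) = cst 0.
    apply/funext => y; rewrite /cst -(integral_bump_eq0 lg (H ^~ (- N%:R) ^~ y)).
    rewrite -Rintegral_itv_bndo_bndc; last first.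
      by apply: integrableS (iN y) => //; exact: subset_itv_co_cc.
    rewrite -Rintegral_itv_obnd_cbnd //.
    by apply: integrableS (iN y) => //; exact: subset_itv_oo_cc.
  by rewrite derive1_cst.
apply: (@filterS _ _ (ae_filter_ringOfSetsType lebesgue_measure) _ _ _ (ae_foralln key)).
move=> x /(_ (Num.truncn `|x|).+1); apply.
rewrite ltrNl; apply: le_lt_trans (ler_norm _) _; rewrite normrN.
exact: truncnS_gt.
Qed.

End bump_theory.

(** * A second-order Taylor formula in mean square *)

Lemma integrable_locallyT (R : realType) (g : R -> R) :
  leb.-integrable setT (EFin \o g) -> locally_integrable setT g.
Proof.
move=> ig; have [mE gfin] := integrableP _ _ _ ig.
split; [exact/measurable_EFinP|exact: openT|move=> K _ cK].
have mK := compact_measurable cK.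
apply: le_lt_trans gfin; apply: ge0_subset_integral => //.
apply/measurable_EFinP; apply: measurableT_comp => //; exact/measurable_EFinP.
Qed.

Lemma L2_locally_integrable (R : realType) (g : R -> R) :
  measurable_fun setT g -> (\int[leb]_x (g x ^+ 2)%:E < +oo)%E ->
  locally_integrable setT g.
Proof.
move=> mg g2; split => //; first exact: openT.
move=> K _ cK.
have mK := compact_measurable cK.
have mg2 : measurable_fun setT (fun x => (g x ^+ 2)%:E).
  by apply/measurable_EFinP; exact: measurable_funX.
apply: (@le_lt_trans _ _ (\int[leb]_(x in K) (1 + (g x ^+ 2)%:E))%E).
  apply: ge0_le_integral => //.
  - apply: measurable_funTS; apply/measurable_EFinP; exact: measurableT_comp.
  - by apply: emeasurable_funD => //; exact: measurable_funTS.
  - move=> x _; rewrite -EFinD lee_fin -[X in 1 + X](real_normK (num_real _)).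
    have := sqr_ge0 (`|g x| - 1); have := normr_ge0 (g x); nra.
rewrite ge0_integralD //; last 2 first.
- by move=> x _; rewrite lee_fin sqr_ge0.
- exact: measurable_funTS.
rewrite integral_cst // mul1e; apply: lte_add_pinfty.
  exact: compact_finite_measure.
apply: le_lt_trans g2; apply: ge0_subset_integral => //.
by move=> x _; rewrite lee_fin sqr_ge0.
Qed.

(** The weight of the integral remainder in Taylor's formula at order two. *)
Definition taylor_weight (R : realType) (t : R) : R :=
  (1 - t) * \1_(`[0, 1]%classic : set R) t.
Arguments taylor_weight {R}.

Section taylor_weight.
Context {R : realType}.
Notation w := (@taylor_weight R).

Lemma taylor_weight_ge0 (t : R) : 0 <= w t.
Proof.
rewrite /taylor_weight indicE; case: (boolP (t \in _)) => [|_]; last by rewrite mulr0.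
by rewrite inE /= in_itv /= mulr1 subr_ge0 => /andP[].
Qed.

Lemma measurable_taylor_weight : measurable_fun setT w.
Proof. by apply: measurable_funM => //; apply: measurable_funB. Qed.

Lemma integral_taylor_weight (G : R -> R) :
  (\int[leb]_t (w t * G t)%:E = \int[leb]_(t in `[0%R, 1%R]) ((1 - t) * G t)%:E)%E.
Proof.
rewrite [RHS]integral_mkcond epatch_indic; apply: eq_integral => t _.
by rewrite /= /taylor_weight -EFinM; congr EFin; ring.
Qed.

Lemma is_derive_continuous (F : R -> R) : (forall t, derivable F t 1) -> continuous F.
Proof. by move=> dF t; apply: differentiable_continuous; apply/derivable1_diffP. Qed.

Lemma integral01_derive (F g : R -> R) :
  (forall t : R, is_derive t 1 F (g t)) -> continuous g ->
  (\int[leb]_(t in `[0%R, 1%R]) (g t)%:E = (F 1 - F 0)%:E)%E.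
Proof.
move=> dF cg.
have cF : continuous F by apply: is_derive_continuous => t; exact: ex_derive.
rewrite (@continuous_FTC2 _ g F) //.
- exact: continuous_subspaceT.
- split => [t _||]; first exact: ex_derive.
  + exact/cvg_at_right_filter/cF.
  + exact/cvg_at_left_filter/cF.
- by move=> t _; rewrite derive1E; exact: derive_val.
Qed.

Lemma taylor_weight_integral1 : (\int[leb]_t (w t)%:E = (2^-1)%:E)%E.
Proof.
have -> : (\int[leb]_t (w t)%:E = \int[leb]_t (w t * cst 1 t)%:E)%E.
  by apply: eq_integral => t _; rewrite mulr1.
rewrite integral_taylor_weight.
have dF (t : R) : is_derive t 1 (fun t => - (2^-1 * (1 - t) ^+ 2)) ((1 - t) * cst 1 t).
  have d1 : is_derive t 1 (fun t : R => 1 - t) (-1).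
    have := is_deriveB (is_derive_cst (1 : R) t 1) (is_derive_id t 1).
    by move=> /is_derive_eq; apply; rewrite sub0r.
  have := is_deriveN (is_deriveZ 2^-1 (is_deriveX 2 d1)); rewrite exprfctE.
  by move=> /is_derive_eq; apply; rewrite /GRing.scale /= expr1; field.
have cg : continuous (fun t : R => (1 - t) * cst 1 t).
  by move=> t; apply: cvgM; [apply: cvgB; [exact: cvg_cst|exact: cvg_id]|exact: cvg_cst].
by rewrite (integral01_derive dF cg); congr EFin; field.
Qed.

Lemma integrable_taylor_weight : leb.-integrable setT (EFin \o w).
Proof.
apply/integrableP; split; first by apply/measurable_EFinP; exact: measurable_taylor_weight.
rewrite (_ : (fun x => _) = (fun t => (w t)%:E)); last first.
  by apply/funext => t; rewrite /= ger0_norm ?taylor_weight_ge0.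
by rewrite taylor_weight_integral1 ltry.
Qed.

(** The function t |-> phi (x + t s) + (1 - t) s phi' (x + t s) has derivative
    (1 - t) s^2 phi'' (x + t s). *)
Lemma taylor_integral_remainder (phi : R -> R) (x s : R) :
  bounded_smooth 3 phi ->
  (\int[leb]_t (w t * (s ^+ 2 * (phi^`(2))%classic (x + t * s)))%:E =
   (phi (x + s) - phi x - s * (phi^`())%classic x)%:E)%E.
Proof.
move=> sphi.
have d1 (y : R) : is_derive y 1 phi ((phi^`())%classic y).
  by rewrite derive1E; apply: DeriveDef => //; exact: bounded_smooth_derivable sphi.
have sphi1 := @bounded_smooth_derive1n _ 1 2 _ sphi.
have d2 (y : R) : is_derive y 1 (phi^`())%classic ((phi^`(2))%classic y).
  rewrite [(phi^`(2))%classic]/= derive1E; apply: DeriveDef => //.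
  exact: bounded_smooth_derivable sphi1.
have c2 : continuous (phi^`(2))%classic.
  apply: is_derive_continuous => y.
  exact: (@bounded_smooth_derivable _ 0 _ y (@bounded_smooth_derive1n _ 2 1 _ sphi)).
have da (t : R) : is_derive t 1 (fun t : R => x + t * s) s.
  have := is_deriveD (is_derive_cst x t 1) (is_deriveZ s (is_derive_id t 1)).
  rewrite (_ : (fun t => x + t * s) = (fun t => x + s *: t)); last first.
    by apply/funext => u; rewrite /GRing.scale /= mulrC.
  by move=> /is_derive_eq; apply; rewrite add0r /GRing.scale /= mulr1.
rewrite integral_taylor_weight.
have dF (t : R) : is_derive t 1
    (fun t => phi (x + t * s) + (1 - t) * (s * (phi^`())%classic (x + t * s)))
    ((1 - t) * (s ^+ 2 * (phi^`(2))%classic (x + t * s))).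
  have db : is_derive t 1 (fun t : R => 1 - t) (-1).
    have := is_deriveB (is_derive_cst (1 : R) t 1) (is_derive_id t 1).
    by move=> /is_derive_eq; apply; rewrite sub0r.
  have e1 := @is_derive1_comp _ phi (fun t => x + t * s) t _ _ (d1 _) (da t).
  have e2 := @is_derive1_comp _ (phi^`())%classic (fun t => x + t * s) t _ _ (d2 _) (da t).
  have := is_deriveD e1 (is_deriveM db (is_deriveZ s e2)).
  by move=> /is_derive_eq; apply; rewrite /GRing.scale /= /GRing.scale /=; ring.
have cg : continuous (fun t : R => (1 - t) * (s ^+ 2 * (phi^`(2))%classic (x + t * s))).
  move=> t; apply: cvgM; first by apply: cvgB; [exact: cvg_cst|exact: cvg_id].
  apply: cvgM; first exact: cvg_cst.
  apply: (@cvg_comp _ _ _ (fun t => x + t * s) (phi^`(2))%classic _ (nbhs (x + t * s))); last exact: c2.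
  by apply: cvgD; [exact: cvg_cst|apply: cvgM; [exact: cvg_id|exact: cvg_cst]].
by rewrite (integral01_derive dF cg); congr EFin; rewrite mul1r mul0r addr0; ring.
Qed.

End taylor_weight.

Lemma derive1_translate (R : realType) (phi : R -> R) (c : R) :
  (forall x, derivable phi x 1) ->
  ((fun x => phi (x + c))^`() = fun x => (phi^`() (x + c)))%classic.
Proof.
move=> dphi; apply/funext => x.
have dc : is_derive x 1 (fun x : R => x + c) 1.
  have := is_deriveD (is_derive_id x 1) (is_derive_cst c x 1).
  by move=> /is_derive_eq; apply; rewrite addr0.
have dx : is_derive (x + c) 1 phi ((phi^`())%classic (x + c)).
  by rewrite derive1E; apply: DeriveDef.
have d := @is_derive1_comp _ phi (fun x => x + c) x _ _ dx dc.
by rewrite derive1E -[RHS]mulr1; exact: (derive_val (is_derive := d)).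
Qed.

Section bump_derivatives.
Context {R : realType} (n : nat) (a b : R).
Local Notation phi := (smooth_bump n a b).

Lemma bump_derive2_translate (c x : R) :
  ((smooth_bump n (a - c) (b - c))^`(2))%classic x = (phi^`(2))%classic (x + c).
Proof.
have -> : smooth_bump n (a - c) (b - c) = (fun x => phi (x + c)).
  by apply/funext => y; rewrite bump_translate.
rewrite /= (@derive1_translate _ phi c); last first.
  by move=> y; exact: bounded_smooth_derivable (bounded_smooth_bump 1 n a b).
rewrite (@derive1_translate _ (phi^`())%classic c) // => y.
apply: (@bounded_smooth_derivable _ 0).
exact: (@bounded_smooth_derive1n _ 1 1 phi (bounded_smooth_bump 2 n a b)).
Qed.

Lemma measurable_bump_derive k : measurable_fun setT (phi^`(k))%classic.
Proof.
apply: continuous_measurable_fun; apply: is_derive_continuous => x.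
have [d _] := test_function_bump n a b; exact: d.
Qed.

Lemma bump_derive_bounded k : exists M, forall x, `|(phi^`(k))%classic x| <= M.
Proof.
apply: (@bounded_smooth_bounded _ 0); apply: bounded_smooth_derive1n.
exact: bounded_smooth_bump.
Qed.

End bump_derivatives.

Definition taylor_remainder (R : realType) (g : R -> R) (s x : R) : R :=
  \int[leb]_t (taylor_weight t * g (x - t * s)).

Section l2_taylor.
Context {R : realType} (f f2 : R -> R).
Hypothesis weak : weak_second_derivative f f2.
Hypothesis int_f : leb.-integrable setT (EFin \o f).
Hypothesis f2_sqr : (\int[leb]_x (f2 x ^+ 2)%:E < +oo)%E.
Local Notation w := (@taylor_weight R).

Let mf : measurable_fun setT f. Proof. by case: weak => -[]. Qed.
Let mf2 : measurable_fun setT f2. Proof. by case: weak => _ []. Qed.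
Let mw := @measurable_taylor_weight R.

Let mf2s (s : R) : measurable_fun setT (fun z : R * R => f2 (z.2 - z.1 * s)).
Proof.
apply: measurableT_comp => //; apply: measurable_funB => //.
exact: measurable_funM.
Qed.

Let sqr_translate (s : R) :
  (\int[leb]_x (f2 (x - s) ^+ 2)%:E = \int[leb]_x (f2 x ^+ 2)%:E)%E.
Proof.
apply: (@ge0_integral_translate _ s (fun x => (f2 x ^+ 2)%:E)).
  by apply/measurable_EFinP; exact: measurable_funX.
by move=> x; rewrite lee_fin sqr_ge0.
Qed.

(** A translated bump is again a bump, hence a test function. *)
Lemma weak_derivative_translate n (a b c : R) :
  \int[leb]_x (f x * ((smooth_bump n a b)^`(2))%classic (x + c)) =
  \int[leb]_x (f2 (x - c) * smooth_bump n a b x).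
Proof.
have [_ _ W] := weak.
have := W _ (test_function_bump n (a - c) (b - c)).
rewrite -[X in X = _](Rintegral_translate (- c)); last first.
  by apply: measurable_funM => //; exact: measurable_bump.
have -> : \int[leb]_x (f2 (x - c) * smooth_bump n (a - c) (b - c) (x - c)) =
    \int[leb]_x (f2 (x - c) * smooth_bump n a b x).
  by apply: eq_Rintegral => x _; rewrite -bump_translate subrK.
by move=> ->; apply: eq_Rintegral => x _; rewrite bump_derive2_translate.
Qed.

Let phi2_sqr n (a b : R) : (\int[leb]_x (smooth_bump n a b x ^+ 2)%:E < +oo)%E.
Proof.
apply: (@le_lt_trans _ _ (\int[leb]_x (\1_(`]a, b[%classic : set R) x)%:E)%E).
  apply: ge0_le_integral => //.
  - by move=> x _; rewrite lee_fin sqr_ge0.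
  - by apply/measurable_EFinP; apply: measurable_funX; exact: measurable_bump.
  - by apply/measurable_EFinP; apply: measurable_indic.
  - move=> x _; rewrite lee_fin; apply: le_trans (bump_le_indic n a b x).
    by rewrite expr2 ler_piMl ?bump_ge0 ?bump_le1.
have fin : (leb (`]a, b[%classic `&` setT : set R) < +oo)%E.
  by rewrite setIT lebesgue_measure_itv /=; case: ifP => _; rewrite ltry.
by rewrite integral_indic.
Qed.

Let integrable_remainder n (a b s : R) :
  (leb \x leb)%E.-integrable setT (EFin \o (fun z : measurableTypeR R * measurableTypeR R =>
     w z.1 * (s ^+ 2 * (f2 (z.2 - z.1 * s) * smooth_bump n a b z.2)))).
Proof.
have mphi2 : measurable_fun setT (fun x => (smooth_bump n a b x ^+ 2)%:E).
  by apply/measurable_EFinP; apply: measurable_funX; exact: measurable_bump.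
have fin2 : (\int[leb]_x (f2 x ^+ 2)%:E)%E \is a fin_num.
  by rewrite ge0_fin_numE // integral_ge0 // => x _; rewrite lee_fin sqr_ge0.
have finp : (\int[leb]_x (smooth_bump n a b x ^+ 2)%:E)%E \is a fin_num.
  by rewrite ge0_fin_numE // integral_ge0 // => x _; rewrite lee_fin sqr_ge0.
pose C := s ^+ 2 * (fine (\int[leb]_x (f2 x ^+ 2)%:E)%E +
                    fine (\int[leb]_x (smooth_bump n a b x ^+ 2)%:E)%E).
apply: (@integrable_prod_bound _ _ (measurableTypeR R) (measurableTypeR R) R leb leb _ w C).
- apply: measurable_funM; first exact: measurableT_comp.
  apply: measurable_funM => //; apply: measurable_funM; first exact: mf2s.
  by apply: measurableT_comp => //; exact: measurable_bump.
- exact: integrable_taylor_weight.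
- move=> t /=.
  have mf2t : measurable_fun setT (fun x : R => (f2 (x - t * s) ^+ 2)%:E).
    apply/measurable_EFinP; apply: measurable_funX; exact: measurable_translate.
  apply: (@le_trans _ _ (\int[leb]_x ((`|w t| * s ^+ 2)%:E *
      ((f2 (x - t * s) ^+ 2)%:E + (smooth_bump n a b x ^+ 2)%:E)))%E).
    apply: ge0_le_integral => //.
    + apply/measurable_EFinP; apply: measurableT_comp => //.
      apply: measurable_funM => //; apply: measurable_funM => //.
      apply: measurable_funM; [exact: measurable_translate|exact: measurable_bump].
    + by apply: emeasurable_funM => //; exact: emeasurable_funD.
    + move=> x _; rewrite -EFinD -EFinM lee_fin (normrM (w t)) -[leRHS]mulrA ler_wpM2l //.
      by rewrite normrM (ger0_norm (sqr_ge0 s)) ler_wpM2l ?sqr_ge0 // normM_le_sqrD.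
  rewrite ge0_integralZl //; last 3 first.
  - exact: emeasurable_funD.
  - by move=> x _; rewrite -EFinD lee_fin addr_ge0 ?sqr_ge0.
  - by rewrite lee_fin mulr_ge0 ?sqr_ge0.
  rewrite ge0_integralD //; last 2 first.
  - by move=> x _; rewrite lee_fin sqr_ge0.
  - by move=> x _; rewrite lee_fin sqr_ge0.
  rewrite sqr_translate -(fineK fin2) -(fineK finp) -EFinD -EFinM lee_fin /C.
  by rewrite -[leLHS]mulrA lexx.
Qed.

Let mphi2s n (a b s : R) : measurable_fun setT (fun z : R * R =>
  ((smooth_bump n a b)^`(2))%classic (z.2 + z.1 * s)).
Proof.
apply: measurableT_comp; first exact: measurable_bump_derive.
by apply: measurable_funD => //; exact: measurable_funM.
Qed.

Lemma measurable_remainder s : measurable_fun setT (taylor_remainder f2 s).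
Proof.
apply: (@measurable_Rintegral _ _ (measurableTypeR R) (measurableTypeR R) R leb
  (fun z => w z.1 * f2 (z.2 - z.1 * s))).
apply: measurable_funM; [exact: measurableT_comp|exact: mf2s].
Qed.

(** Taylor's formula for the bump, integrated against f; exchanging the
    integrals puts the second derivative on f, for each t separately. *)
Lemma weak_taylor n (a b s : R) :
  \int[leb]_x (f x * (smooth_bump n a b (x + s) - smooth_bump n a b x
                     - s * ((smooth_bump n a b)^`())%classic x)) =
  \int[leb]_x (s ^+ 2 * (taylor_remainder f2 s x * smooth_bump n a b x)).
Proof.
have [M phiM] := bump_derive_bounded n a b 2.
have m2 (c : R) : measurable_fun setT (fun x : R => ((smooth_bump n a b)^`(2))%classic (x + c)).
  apply: measurableT_comp; first exact: measurable_bump_derive.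
  exact: measurable_funD.
pose G (z : measurableTypeR R * measurableTypeR R) :=
  w z.1 * (s ^+ 2 * (f z.2 * ((smooth_bump n a b)^`(2))%classic (z.2 + z.1 * s))).
pose I := fine (\int[leb]_x `|f x|%:E)%E.
have fI : (\int[leb]_x `|f x|%:E)%E = I%:E.
  by rewrite fineK // ge0_fin_numE ?integral_ge0 //; case/integrableP : int_f.
clearbody I.
have iG : (leb \x leb)%E.-integrable setT (EFin \o G).
  apply: (@integrable_prod_bound _ _ (measurableTypeR R) (measurableTypeR R) R leb leb _ w
    (s ^+ 2 * (I * M))).
  - apply: measurable_funM; first exact: measurableT_comp.
    apply: measurable_funM => //; apply: measurable_funM; last exact: mphi2s.
    exact: measurableT_comp.
  - exact: integrable_taylor_weight.
  - move=> t; rewrite /G /=.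
    have M0 : 0 <= M by rewrite (le_trans _ (phiM 0)).
    apply: (@le_trans _ _ (\int[leb]_x ((`|w t| * (s ^+ 2 * M))%:E * `|f x|%:E))%E).
      apply: ge0_le_integral => //.
      + apply/measurable_EFinP; apply: measurableT_comp => //.
        by do 2 apply: measurable_funM => //; apply: measurable_funM => //; exact: m2.
      + by apply: emeasurable_funM => //; apply/measurable_EFinP; exact: measurableT_comp.
      + move=> x _; rewrite -EFinM lee_fin (normrM (w t)) -[leRHS]mulrA ler_wpM2l //.
        rewrite normrM (ger0_norm (sqr_ge0 s)) -[leRHS]mulrA ler_wpM2l ?sqr_ge0 //.
        rewrite normrM [leLHS]mulrC ler_wpM2r //; exact: phiM.
    rewrite ge0_integralZl //; last 2 first.
    - by apply/measurable_EFinP; exact: measurableT_comp.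
    - by rewrite lee_fin mulr_ge0 // mulr_ge0 ?sqr_ge0.
    rewrite fI -EFinM lee_fin.
    by rewrite le_eqVlt; apply/orP; left; apply/eqP; ring.
transitivity (\int[leb]_x \int[leb]_t G (t, x)).
  apply: eq_Rintegral => x _; rewrite /G /=.
  have -> : smooth_bump n a b (x + s) - smooth_bump n a b x
      - s * ((smooth_bump n a b)^`())%classic x =
      \int[leb]_t (w t * (s ^+ 2 * ((smooth_bump n a b)^`(2))%classic (x + t * s))).
    rewrite /Rintegral taylor_integral_remainder //; exact: bounded_smooth_bump.
  rewrite -Rintegral_cMl; first by apply: eq_Rintegral => t _ /=; ring.
  apply: measurable_funM => //; apply: measurable_funM => //.
  apply: measurableT_comp; first exact: measurable_bump_derive.
  by apply: measurable_funD => //; exact: measurable_funM.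
rewrite -(Rintegral_fubini iG).
transitivity (\int[leb]_t \int[leb]_x
    (w t * (s ^+ 2 * (f2 (x - t * s) * smooth_bump n a b x)))).
  apply: eq_Rintegral => t _; rewrite /G /=.
  have mff : measurable_fun setT (fun x : R =>
      f x * ((smooth_bump n a b)^`(2))%classic (x + t * s)) by apply: measurable_funM => //; exact: m2.
  have mfg : measurable_fun setT (fun x : R => f2 (x - t * s) * smooth_bump n a b x).
    by apply: measurable_funM; [exact: measurable_translate|exact: measurable_bump].
  rewrite !Rintegral_cMl //; [|exact: measurable_funM|exact: measurable_funM].
  by rewrite weak_derivative_translate.
rewrite (Rintegral_fubini (integrable_remainder n a b s)) /=.
apply: eq_Rintegral => x _.
rewrite /taylor_remainder [in RHS]mulrC -mulrA mulrC -Rintegral_cMl; last first.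
  apply: measurable_funM => //; apply: measurableT_comp => //.
  by apply: measurable_funB => //; exact: measurable_funM.
by apply: eq_Rintegral => t _; ring.
Qed.

Let weight_norm_le : (\int[leb]_t `|w t|%:E <= (2^-1)%:E)%E.
Proof.
rewrite le_eqVlt; apply/orP; left; apply/eqP; rewrite -[RHS]taylor_weight_integral1.
by apply: eq_integral => t _; rewrite ger0_norm ?taylor_weight_ge0.
Qed.

Let sqr_remainder_lty s : (\int[leb]_x (taylor_remainder f2 s x ^+ 2)%:E < +oo)%E.
Proof.
have w1 := weight_norm_le.
apply: le_lt_trans (@integral_weighted_cauchy_schwarz _ _ (measurableTypeR R)
  (measurableTypeR R) R leb leb w (fun z => f2 (z.2 - z.1 * s)) 2^-1 mw (mf2s s) _ w1) _.
  by rewrite invr_gt0.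
under eq_integral do rewrite /= sqr_translate.
have fin2 : (\int[leb]_x (f2 x ^+ 2)%:E)%E \is a fin_num.
  by rewrite ge0_fin_numE // integral_ge0 // => x _; rewrite lee_fin sqr_ge0.
rewrite ge0_integralZr //.
- rewrite lte_mul_pinfty // lte_mul_pinfty //.
  + exact: integral_ge0.
  + by rewrite ge0_fin_numE ?integral_ge0 // (le_lt_trans w1) // ltry.
- by apply/measurable_EFinP; exact: measurableT_comp.
- by apply: integral_ge0 => x _; rewrite lee_fin sqr_ge0.
Qed.

Let integrable_f_bump n (a b c : R) k :
  leb.-integrable setT (EFin \o (fun x => f (x + c) * ((smooth_bump n a b)^`(k))%classic x)).
Proof.
have [M phiM] := bump_derive_bounded n a b k.
apply: (@integrable_mul_bounded _ _ _ leb (fun x => f (x + c)) _ M) => //.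
  exact: integrable_translate.
exact: measurable_bump_derive.
Qed.

Let integrable_remainder_bump n (a b s : R) :
  leb.-integrable setT (EFin \o (fun x => taylor_remainder f2 s x * smooth_bump n a b x)).
Proof.
apply: integrable_sqr_mul => //; first exact: measurable_remainder.
exact: measurable_bump.
Qed.

(** Minus the weak first derivative of f, isolated from Taylor's formula with
    step 1. *)
Definition taylor_slope (x : R) : R := f (x - 1) - f x - taylor_remainder f2 1 x.

Let measurable_slope : measurable_fun setT taylor_slope.
Proof.
apply: measurable_funB; last exact: measurable_remainder.
by apply: measurable_funB => //; exact: measurable_translate.
Qed.

Let weak_taylor_shifted n (a b s : R) :
  \int[leb]_x (f (x - s) * smooth_bump n a b x) - \int[leb]_x (f x * smooth_bump n a b x)
  - s * \int[leb]_x (f x * ((smooth_bump n a b)^`())%classic x) =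
  s ^+ 2 * \int[leb]_x (taylor_remainder f2 s x * smooth_bump n a b x).
Proof.
have i0 := integrable_f_bump n a b 0 0.
have i1 := integrable_f_bump n a b 0 1.
have is_ := integrable_f_bump n a b (- s) 0.
have e0 (g : R -> R) : leb.-integrable setT (EFin \o (fun x => f (x + 0) * g x)) ->
    leb.-integrable setT (EFin \o (fun x => f x * g x)).
  by apply: eq_integrable => // x _; rewrite /= addr0.
move: i0 i1 => /e0 i0 /e0 i1.
rewrite -[RHS]Rintegral_cMl; last first.
  apply: measurable_funM; [exact: measurable_remainder|exact: measurable_bump].
rewrite -weak_taylor.
have it := integrable_translate s is_.
have i2 : leb.-integrable setT (EFin \o (fun x => f x * smooth_bump n a b (x + s))).
  by move: it; apply: eq_integrable => // x _; rewrite /= addrK.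
have i3 : leb.-integrable setT
    (EFin \o (fun x => s * (f x * ((smooth_bump n a b)^`())%classic x))).
  by have := integrableZl measurableT s i1; apply: eq_integrable.
have i4 : leb.-integrable setT
    (EFin \o (fun x => f x * smooth_bump n a b (x + s) - f x * smooth_bump n a b x)).
  by have := integrableB measurableT i2 i0; apply: eq_integrable.
transitivity (\int[leb]_x (f x * smooth_bump n a b (x + s) - f x * smooth_bump n a b x
    - s * (f x * ((smooth_bump n a b)^`())%classic x))); last first.
  by apply: eq_Rintegral => x _; ring.
rewrite (RintegralB measurableT i4 i3) (RintegralB measurableT i2 i0).
rewrite Rintegral_cMl; last by case/integrableP: i1 => /measurable_EFinP.
have -> : \int[leb]_x (f (x - s) * smooth_bump n a b x) =
    \int[leb]_x (f x * smooth_bump n a b (x + s)) => //.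
rewrite -(Rintegral_translate s); last by case/integrableP: is_ => /measurable_EFinP.
by apply: eq_Rintegral => x _; rewrite addrK.
Qed.

(** Against a bump phi, the Taylor formulas with steps s and 1 both contain
    the integral of f phi'; eliminating it leaves a relation between functions. *)
Lemma taylor_ae s : {ae leb, forall x,
  f (x - s) - f x - s * taylor_slope x = s ^+ 2 * taylor_remainder f2 s x}.
Proof.
have lf (c : R) : locally_integrable setT (fun x => f (x - c)).
  exact: integrable_locallyT (integrable_translate (- c) int_f).
have lf0 : locally_integrable setT f by case: weak.
have lr (c : R) : locally_integrable setT (taylor_remainder f2 c).
  by apply: L2_locally_integrable => //; exact: measurable_remainder.
have lZ (c : R) (g : R -> R) : locally_integrable setT g ->
    locally_integrable setT (fun x => c * g x).
  move=> [mg _ ig]; split => //; [exact: measurable_funM|exact: openT|].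
  move=> K KT cK; under eq_integral do rewrite normrM EFinM.
  have mK := compact_measurable cK.
  rewrite ge0_integralZl //; last first.
    by apply/measurable_EFinP/measurable_funTS; exact: measurableT_comp.
  by rewrite lte_mul_pinfty // ig.
have ls : locally_integrable setT taylor_slope.
  exact: (locally_integrableB (locally_integrableB (lf 1) lf0) (lr 1)).
pose g x := f (x - s) - f x - s * taylor_slope x - s ^+ 2 * taylor_remainder f2 s x.
have lg : locally_integrable setT g.
  exact: (locally_integrableB (locally_integrableB (locally_integrableB (lf s) lf0)
    (lZ s _ ls)) (lZ (s ^+ 2) _ (lr s))).
suff H : {ae leb, forall x, g x = 0}.
  apply: (@filterS _ _ (ae_filter_ringOfSetsType leb) _ _ _ H) => x.
  by rewrite /g => /eqP; rewrite subr_eq0 => /eqP.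
apply: bump_orthogonal_ae0 => // n a b.
have is_ (c : R) := integrable_f_bump n a b (- c) 0.
have i0 : leb.-integrable setT (EFin \o (fun x => f x * smooth_bump n a b x)).
  by have := integrable_f_bump n a b 0 0; apply: eq_integrable => // x _; rewrite /= addr0.
have ir (c : R) := integrable_remainder_bump n a b c.
have isl : leb.-integrable setT (EFin \o (fun x => taylor_slope x * smooth_bump n a b x)).
  have := integrable_subr _ _ (integrable_subr _ _ (is_ 1) i0) (ir 1); apply: eq_integrable => // x _ /=.
  by congr EFin; rewrite /taylor_slope /=; ring.
have slopeE : \int[leb]_x (taylor_slope x * smooth_bump n a b x) =
    \int[leb]_x (f x * ((smooth_bump n a b)^`())%classic x).
  have := weak_taylor_shifted n a b 1; rewrite expr1n !mul1r => W.
  transitivity (\int[leb]_x (f (x - 1) * smooth_bump n a b x - f x * smooth_bump n a b x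
      - taylor_remainder f2 1 x * smooth_bump n a b x)).
    by apply: eq_Rintegral => x _; rewrite /taylor_slope; ring.
  rewrite (RintegralB measurableT (integrable_subr _ _ (is_ 1) i0) (ir 1)).
  rewrite (RintegralB measurableT (is_ 1) i0) -W /=; ring.
transitivity (\int[leb]_x (f (x - s) * smooth_bump n a b x - f x * smooth_bump n a b x
   - s * (taylor_slope x * smooth_bump n a b x)
   - s ^+ 2 * (taylor_remainder f2 s x * smooth_bump n a b x))).
  by apply: eq_Rintegral => x _; rewrite /g; ring.
rewrite (RintegralB measurableT (integrable_subr _ _ (integrable_subr _ _ (is_ s) i0) (integrable_cMl s _ isl)) (integrable_cMl (s ^+ 2) _ (ir s))).
rewrite (RintegralB measurableT (integrable_subr _ _ (is_ s) i0) (integrable_cMl s _ isl)).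
rewrite (RintegralB measurableT (is_ s) i0).
have msl : measurable_fun setT (fun x : R => taylor_slope x * smooth_bump n a b x).
  by apply: measurable_funM => //; exact: measurable_bump.
have mr : measurable_fun setT (fun x : R => taylor_remainder f2 s x * smooth_bump n a b x).
  by apply: measurable_funM; [exact: measurable_remainder|exact: measurable_bump].
have Es : \int[leb]_x (s * (taylor_slope x * smooth_bump n a b x)) =
  s * \int[leb]_x (taylor_slope x * smooth_bump n a b x) := Rintegral_cMl leb s msl.
have Er : \int[leb]_x (s ^+ 2 * (taylor_remainder f2 s x * smooth_bump n a b x)) =
  s ^+ 2 * \int[leb]_x (taylor_remainder f2 s x * smooth_bump n a b x) :=
  Rintegral_cMl leb (s ^+ 2) mr.
rewrite Es Er.
by rewrite slopeE -weak_taylor_shifted /=; ring.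
Qed.

Let sqr_fin : (\int[leb]_x (f2 x ^+ 2)%:E)%E \is a fin_num.
Proof. by rewrite ge0_fin_numE // integral_ge0 // => x _; rewrite lee_fin sqr_ge0. Qed.

Let ae_integrable_weight_translate s : {ae leb, forall x,
  leb.-integrable setT (EFin \o (fun t => w t * f2 (x - t * s)))}.
Proof.
pose F (z : measurableTypeR R * measurableTypeR R) := w z.1 * f2 (z.2 - z.1 * s) ^+ 2.
have mF : measurable_fun setT F.
  by apply: measurable_funM; [exact: measurableT_comp|apply: measurable_funX; exact: mf2s].
have iF : (leb \x leb)%E.-integrable setT (EFin \o F).
  apply: (@integrable_prod_bound _ _ (measurableTypeR R) (measurableTypeR R) R leb leb _ w
    (fine (\int[leb]_x (f2 x ^+ 2)%:E)%E)) => //.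
    exact: integrable_taylor_weight.
  move=> t; rewrite EFinM fineK // -(sqr_translate (t * s)) -ge0_integralZl //; last 2 first.
  - apply/measurable_EFinP; apply: measurable_funX; exact: measurable_translate.
  - by move=> x _; rewrite lee_fin sqr_ge0.
  rewrite le_eqVlt; apply/orP; left; apply/eqP; apply: eq_integral => x _.
  by rewrite /F /= normrM (ger0_norm (sqr_ge0 _)) EFinM.
apply: (@filterS _ _ (ae_filter_ringOfSetsType leb) _ _ _ (ae_integrable2 iF)) => x ix.
have iw := @integrable_taylor_weight R.
have iD : leb.-integrable setT (fun t => (w t)%:E + (F (t, x))%:E)%E by exact: integrableD.
apply: le_integrable iD => //.
  apply/measurable_EFinP; apply: measurable_funM => //; apply: measurableT_comp => //.
  by apply: measurable_funB => //; exact: measurable_funM.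
move=> t _; rewrite -EFinD /= lee_fin /F /=.
have w0 := taylor_weight_ge0 t.
rewrite normrM (ger0_norm w0) -[X in _ <= `|X + _|]mulr1 -mulrDr normrM (ger0_norm w0).
rewrite ler_wpM2l // [leRHS]ger0_norm ?addr_ge0 ?sqr_ge0 //.
by have := normM_le_sqrD 1 (f2 (x - t * s)); rewrite mul1r expr1n.
Qed.

(** Taylor's remainder at order two over s^2, compared with its limit. *)
Definition taylor_defect (s x : R) : R :=
  (f (x - s) - f x - s * taylor_slope x) / s ^+ 2 - f2 x / 2.

Let taylor_defect_ae s : s != 0 -> {ae leb, forall x,
  taylor_defect s x = \int[leb]_t (w t * (f2 (x - t * s) - f2 x))}.
Proof.
move=> s0.
apply: (@filterS2 _ _ (ae_filter_ringOfSetsType leb) _ _ _ _ (taylor_ae s)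
  (ae_integrable_weight_translate s)) => x tx ix.
rewrite /taylor_defect tx mulrAC mulfV ?expf_neq0 // mul1r.
have iwx : leb.-integrable setT (EFin \o (fun t => w t * f2 x)).
  by have := integrableZr measurableT (f2 x) (@integrable_taylor_weight R); apply: eq_integrable.
transitivity (\int[leb]_t (w t * f2 (x - t * s) - w t * f2 x)); last first.
  by apply: eq_Rintegral => t _; rewrite mulrBr.
rewrite (RintegralB measurableT ix iwx) /taylor_remainder; congr (_ - _).
have -> : \int[leb]_t (w t * f2 x) = \int[leb]_t (f2 x * w t).
  by apply: eq_Rintegral => t _; rewrite mulrC.
by rewrite Rintegral_cMl // /Rintegral taylor_weight_integral1.
Qed.

Let modulus (s : R) : \bar R := (\int[leb]_x ((f2 (x - s) - f2 x) ^+ 2)%:E)%E.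

Let modulus_ge0 s : (0 <= modulus s)%E.
Proof. by apply: integral_ge0 => x _; rewrite lee_fin sqr_ge0. Qed.

Let modulus_le s : (modulus s <= 4%:E * \int[leb]_x (f2 x ^+ 2)%:E)%E.
Proof.
have mt (c : R) : measurable_fun setT (fun x : R => (f2 (x - c) ^+ 2)%:E).
  by apply/measurable_EFinP; apply: measurable_funX; exact: measurable_translate.
have m0 : measurable_fun setT (fun x : R => (f2 x ^+ 2)%:E).
  by apply/measurable_EFinP; exact: measurable_funX.
apply: (@le_trans _ _ (\int[leb]_x (2%:E * ((f2 (x - s) ^+ 2)%:E + (f2 x ^+ 2)%:E)))%E).
  apply: ge0_le_integral => //.
  - by move=> x _; rewrite lee_fin sqr_ge0.
  - apply/measurable_EFinP; apply: measurable_funX; apply: measurable_funB => //.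
    exact: measurable_translate.
  - by apply: emeasurable_funM => //; apply: emeasurable_funD => //; exact: mt.
  - move=> x _; rewrite -EFinD -EFinM lee_fin.
    have := sqr_ge0 (f2 (x - s) + f2 x); nra.
rewrite ge0_integralZl //; last 2 first.
- by apply: emeasurable_funD => //; exact: mt.
- by move=> x _; rewrite -EFinD lee_fin addr_ge0 ?sqr_ge0.
rewrite ge0_integralD //; last 3 first.
- by move=> x _; rewrite lee_fin sqr_ge0.
- exact: mt.
- by move=> x _; rewrite lee_fin sqr_ge0.
rewrite sqr_translate -(fineK sqr_fin) -EFinD -!EFinM lee_fin.
by move: (fine _) => A; lra.
Qed.

Let measurable_modulus s : measurable_fun setT (fun t : R => modulus (t * s)).
Proof.
apply: (@measurable_fun_fubini_tonelli_F _ _ (measurableTypeR R) (measurableTypeR R) R leb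
  (fun z => ((f2 (z.2 - z.1 * s) - f2 z.2) ^+ 2)%:E)).
- apply/measurable_EFinP; apply: measurable_funX; apply: measurable_funB; first exact: mf2s.
  exact: measurableT_comp.
- by move=> z; rewrite lee_fin sqr_ge0.
Qed.

Lemma measurable_taylor_defect : measurable_fun setT (fun z : R * R => taylor_defect z.1 z.2).
Proof.
apply: measurable_funB; last by apply: measurable_funM => //; exact: measurableT_comp.
apply: measurable_funM.
  apply: measurable_funB; last by apply: measurable_funM => //; exact: measurableT_comp.
  apply: measurable_funB; last exact: measurableT_comp.
  by apply: measurableT_comp => //; exact: measurable_funB.
rewrite (_ : (fun z : R * R => (z.1 ^+ 2)^-1) = (fun z => powR (z.1 ^+ 2) (- 1))).
  apply: (measurableT_comp (measurable_powR _)); exact: measurable_funX.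
by apply/funext => z; rewrite powR_inv1 ?sqr_ge0.
Qed.

Lemma measurable_taylor_defect_section s : measurable_fun setT (taylor_defect s).
Proof.
apply: measurable_funB; last by apply: measurable_funM.
apply: measurable_funM => //.
apply: measurable_funB; last by apply: measurable_funM.
by apply: measurable_funB => //; exact: measurable_translate.
Qed.

Let taylor_defect_sqr s : s != 0 ->
  (\int[leb]_x (taylor_defect s x ^+ 2)%:E <=
   (2^-1)%:E * \int[leb]_t (`|w t|%:E * modulus (t * s)))%E.
Proof.
move=> s0.
pose F (z : measurableTypeR R * measurableTypeR R) := f2 (z.2 - z.1 * s) - f2 z.2.
have mF : measurable_fun setT F.
  by apply: measurable_funB; [exact: mf2s|exact: measurableT_comp].
have h0 : (0 : R) < 2^-1 by rewrite invr_gt0.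
apply: le_trans (@integral_weighted_cauchy_schwarz _ _ (measurableTypeR R)
  (measurableTypeR R) R leb leb w F 2^-1 mw mF h0 weight_norm_le).
rewrite le_eqVlt; apply/orP; left; apply/eqP.
apply: ae_eq_integral => //.
- by apply/measurable_EFinP; apply: measurable_funX; exact: measurable_taylor_defect_section.
- apply/measurable_EFinP; apply: measurable_funX.
  apply: (@measurable_Rintegral _ _ (measurableTypeR R) (measurableTypeR R) R leb
    (fun z => w z.1 * F z)).
  by apply: measurable_funM => //; exact: measurableT_comp.
- apply: (@filterS _ _ (ae_filter_ringOfSetsType leb) _ _ _ (taylor_defect_ae s0)) => x -> _.
  by [].
Qed.

Lemma taylor_defect_bounded s :
  (\int[leb]_x (taylor_defect s x ^+ 2)%:E <= \int[leb]_x (f2 x ^+ 2)%:E)%E.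
Proof.
(* Division by 0 being 0, the defect at s = 0 is - f2 / 2. *)
have [->|s0] := eqVneq s 0.
  apply: ge0_le_integral => //.
  - by move=> x _; rewrite lee_fin sqr_ge0.
  - by apply/measurable_EFinP; apply: measurable_funX; exact: measurable_taylor_defect_section.
  - by apply/measurable_EFinP; apply: measurable_funX.
  - move=> x _; rewrite lee_fin /taylor_defect expr0n /= invr0 mulr0 sub0r.
    by have := sqr_ge0 (f2 x); nra.
apply: le_trans (taylor_defect_sqr s0) _.
apply: (@le_trans _ _ ((2^-1)%:E * \int[leb]_t (`|w t|%:E *
    (4%:E * \int[leb]_x (f2 x ^+ 2)%:E)))%E).
  apply: lee_wpmul2l; first by rewrite lee_fin invr_ge0.
  apply: ge0_le_integral => //.
  - by move=> t _; rewrite mule_ge0 // lee_fin.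
  - apply: emeasurable_funM; last exact: measurable_modulus.
    by apply/measurable_EFinP; exact: measurableT_comp.
  - by apply: emeasurable_funM => //; apply/measurable_EFinP; exact: measurableT_comp.
  - by move=> t _; apply: lee_wpmul2l; rewrite ?lee_fin.
rewrite -(fineK sqr_fin) -EFinM; have : 0 <= fine (\int[leb]_x (f2 x ^+ 2)%:E)%E.
  by rewrite fine_ge0 // integral_ge0 // => x _; rewrite lee_fin sqr_ge0.
move: (fine _) => A A0.
rewrite ge0_integralZr //; last 2 first.
- by apply/measurable_EFinP; exact: measurableT_comp.
- by rewrite lee_fin mulr_ge0.
apply: (@le_trans _ _ ((2^-1)%:E * ((2^-1)%:E * (4 * A)%:E))%E).
  apply: lee_wpmul2l; first by rewrite lee_fin invr_ge0.
  by apply: lee_wpmul2r => //; rewrite lee_fin mulr_ge0.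
by rewrite -!EFinM lee_fin; lra.
Qed.

(** Up to a constant, the mean square is an average over t in [0, 1] of the
    squared norms of f2 (. - t s) - f2. *)
Lemma taylor_defect_cvg (s : nat -> R) :
  (forall n, s n != 0) -> s n @[n --> \oo] --> 0 ->
  (\int[leb]_x (taylor_defect (s n) x ^+ 2)%:E)%E @[n --> \oo] --> 0%E.
Proof.
move=> sn0 s0.
have cv : ((2^-1)%:E * \int[leb]_t (`|w t|%:E * modulus (t * s n)))%E @[n --> \oo] --> 0%E.
  pose A := fine (4%:E * \int[leb]_x (f2 x ^+ 2)%:E)%E.
  have AE : (4%:E * \int[leb]_x (f2 x ^+ 2)%:E = A%:E)%E by rewrite fineK // fin_numM.
  pose F n (t : R) := (`|w t|%:E * modulus (t * s n))%E.
  have mF n : measurable_fun setT (F n).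
    apply: emeasurable_funM; last exact: measurable_modulus.
    by apply/measurable_EFinP; exact: measurableT_comp.
  have H1 : {ae leb, forall t, setT t -> F ^~ t @ \oo --> (cst 0%E : R -> \bar R) t}.
    apply: aeW => t _; rewrite /F /cst -[X in _ --> X](mule0 (`|w t|%:E)).
    apply: cvgeZl => //.
    apply: L2_translation_cvg => //.
    by rewrite -(mulr0 t); apply: cvgM => //; exact: cvg_cst.
  have iD : leb.-integrable setT (fun t => (`|w t|%:E * A%:E)%E).
    apply: integrableZr => //; exact: (integrable_abse (@integrable_taylor_weight R)).
  have H2 : {ae leb, forall t n, setT t -> (`|F n t| <= `|w t|%:E * A%:E)%E}.
    apply: aeW => t n _; rewrite gee0_abs ?mule_ge0 ?lee_fin //.
    by apply: lee_wpmul2l; rewrite ?lee_fin // -AE.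
  have [_ _] := @dominated_convergence _ _ _ leb setT measurableT F (cst 0%E) _ mF
    (measurable_cst _) H1 iD H2.
  rewrite integral0 => cv; rewrite -[X in _ --> X](mule0 (2^-1)%:E).
  exact: cvgeZl.
apply: (@squeeze_cvge _ _ _ _ (cst 0%E) _ _ _ _ _ cv) => //; last exact: cvg_cst.
apply: nearW => n; apply/andP; split.
  by apply: integral_ge0 => x _; rewrite lee_fin sqr_ge0.
exact: taylor_defect_sqr.
Qed.

End l2_taylor.

(** * The bias *)

(** Translations leave the integral of |f| unchanged, so the inner integral is
    a multiple of |g|. *)
Lemma integrable_kernel_product (R : realType) (g f : R -> R) (h : R) :
  leb.-integrable setT (EFin \o g) -> leb.-integrable setT (EFin \o f) ->
  (leb \x leb)%E.-integrable setT (EFin \o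
    (fun z : measurableTypeR R * measurableTypeR R => g z.1 * f (z.2 - h * z.1))).
Proof.
move=> ig int_f; have [mE _] := integrableP _ _ _ ig.
have mg : measurable_fun setT g by exact/measurable_EFinP.
have [mEf ffin] := integrableP _ _ _ int_f.
have mf : measurable_fun setT f by exact/measurable_EFinP.
apply: (@integrable_prod_bound _ _ (measurableTypeR R) (measurableTypeR R) R leb leb _ g
    (fine (\int[leb]_x `|f x|%:E)%E)) => //.
  apply: measurable_funM; first exact: measurableT_comp.
  apply: measurableT_comp => //; apply: measurable_funB => //; exact: measurable_funM.
move=> u; rewrite EFinM fineK; last by rewrite ge0_fin_numE ?integral_ge0.
rewrite -(@ge0_integral_translate _ (h * u) (fun x => `|f x|%:E)) //; last first.
  by apply/measurable_EFinP; exact: measurableT_comp.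
rewrite -ge0_integralZl //; last first.
  apply/measurable_EFinP; apply: measurableT_comp => //; exact: measurable_translate.
rewrite le_eqVlt; apply/orP; left; apply/eqP; apply: eq_integral => x _.
by rewrite /= normrM EFinM.
Qed.

(** The mean of the estimator at x, after the substitution y = x - h u. *)
Definition kernel_mean (R : realType) (K f : R -> R) (h x : R) : R :=
  \int[leb]_u (K u * f (x - h * u)).

Section kernel_bias.
Context {R : realType} (f f2 K : R -> R).
Hypothesis weak : weak_second_derivative f f2.
Hypothesis int_f : leb.-integrable setT (EFin \o f).
Hypothesis f_sqr : (\int[leb]_x (f x ^+ 2)%:E < +oo)%E.
Hypothesis f2_sqr : (\int[leb]_x (f2 x ^+ 2)%:E < +oo)%E.
Hypothesis int_K : leb.-integrable setT (EFin \o K).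
Hypothesis K_int1 : \int[leb]_u K u = 1.
Hypothesis K_mean0 : \int[leb]_u (u * K u) = 0.
Hypothesis K_moment2 : (\int[leb]_u (u ^+ 2 * `|K u|)%:E < +oo)%E.

Let mf : measurable_fun setT f. Proof. by case: weak => -[]. Qed.
Let mf2 : measurable_fun setT f2. Proof. by case: weak => _ []. Qed.
Let mK : measurable_fun setT K. Proof. by case/integrableP: int_K => /measurable_EFinP. Qed.

Let mfs (h : R) : measurable_fun setT (fun z : R * R => f (z.2 - h * z.1)).
Proof.
apply: measurableT_comp => //; apply: measurable_funB => //.
exact: measurable_funM.
Qed.

Let mKf (h : R) : measurable_fun setT (fun z : R * R => K z.1 * f (z.2 - h * z.1)).
Proof. by apply: measurable_funM => //; exact: measurableT_comp. Qed.

Lemma measurable_kernel_mean h : measurable_fun setT (kernel_mean K f h).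
Proof.
exact: (@measurable_Rintegral _ _ (measurableTypeR R) (measurableTypeR R) R leb
  (fun z => K z.1 * f (z.2 - h * z.1)) (mKf h)).
Qed.

(** Convolution with an integrable kernel is bounded in mean square; rescaling
    the kernel by h leaves its norm unchanged. *)
Lemma kernel_mean_sqr_le : exists B : R, forall h,
  (\int[leb]_x (kernel_mean K f h x ^+ 2)%:E <= B%:E)%E.
Proof.
have [_ Kfin] := integrableP _ _ _ int_K.
pose N := fine (\int[leb]_u `|K u|%:E)%E.
have N0 : 0 <= N by rewrite fine_ge0 // integral_ge0.
have KN : (\int[leb]_u `|K u|%:E = N%:E)%E by rewrite fineK // ge0_fin_numE ?integral_ge0.
pose A := fine (\int[leb]_x (f x ^+ 2)%:E)%E.
have fA : (\int[leb]_x (f x ^+ 2)%:E = A%:E)%E.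
  by rewrite fineK // ge0_fin_numE // integral_ge0 // => x _; rewrite lee_fin sqr_ge0.
have A0 : 0 <= A by rewrite fine_ge0 // integral_ge0 // => x _; rewrite lee_fin sqr_ge0.
exists ((N + 1) * (N * A)) => h.
have N1 : 0 < N + 1 by rewrite ltr_wpDl.
have KN1 : (\int[leb]_u `|K u|%:E <= (N + 1)%:E)%E by rewrite KN lee_fin lerDl.
apply: le_trans (@integral_weighted_cauchy_schwarz _ _ (measurableTypeR R)
  (measurableTypeR R) R leb leb K (fun z => f (z.2 - h * z.1)) (N + 1) mK (mfs h) N1 KN1) _.
have tr (u : R) : (\int[leb]_x (f (x - h * u) ^+ 2)%:E = A%:E)%E.
  rewrite (@ge0_integral_translate _ (h * u) (fun x => (f x ^+ 2)%:E)) //.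
  - by apply/measurable_EFinP; exact: measurable_funX.
  - by move=> x; rewrite lee_fin sqr_ge0.
under eq_integral do rewrite /= tr.
rewrite ge0_integralZr //; last by apply/measurable_EFinP; exact: measurableT_comp.
by rewrite KN.
Qed.

Let ae_integrable_kernel (h : R) : {ae leb, forall x,
  leb.-integrable setT (EFin \o (fun u => K u * f (x - h * u)))}.
Proof. exact: (ae_integrable2 (integrable_kernel_product h int_K int_f)). Qed.

Let integrable_uuK : leb.-integrable setT (EFin \o (fun u => u ^+ 2 * K u)).
Proof.
apply/integrableP; split.
  by apply/measurable_EFinP; apply: measurable_funM.
apply: le_lt_trans K_moment2; rewrite le_eqVlt; apply/orP; left; apply/eqP.
by apply: eq_integral => u _; rewrite /= normrM (ger0_norm (sqr_ge0 u)).
Qed.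

Let integrable_uK : leb.-integrable setT (EFin \o (fun u => u * K u)).
Proof.
have i1 := integrable_abse int_K; have i2 := integrable_abse integrable_uuK.
have iD := integrableD measurableT i1 i2.
apply: le_integrable iD => //.
  by apply/measurable_EFinP; apply: measurable_funM.
move=> u _ /=; rewrite lee_fin [leRHS]ger0_norm ?addr_ge0 // (normrM u) (normrM (u ^+ 2)).
rewrite -[X in _ <= X + _]mul1r -mulrDl ler_wpM2r //.
by rewrite (ger0_norm (sqr_ge0 u)) addrC;
  have := normM_le_sqrD u 1; rewrite mulr1 expr1n.
Qed.

Definition bias_error (h x : R) : R :=
  kernel_mean K f h x - f x - h ^+ 2 * (mu2 K / 2) * f2 x.

Let measurable_bias_error h : measurable_fun setT (bias_error h).
Proof.
apply: measurable_funB; last by apply: measurable_funM.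
by apply: measurable_funB => //; exact: measurable_kernel_mean.
Qed.

Let bias_error_ae h : h != 0 -> {ae leb, forall x,
  bias_error h x = \int[leb]_u ((u ^+ 2 * K u) * (h ^+ 2 * taylor_defect f f2 (h * u) x))}.
Proof.
move=> h0.
apply: (@filterS _ _ (ae_filter_ringOfSetsType leb) _ _ _ (ae_integrable_kernel h)) => x ix.
transitivity (\int[leb]_u (K u * f (x - h * u) - f x * K u
    - (h * taylor_slope f f2 x) * (u * K u) - (h ^+ 2 / 2 * f2 x) * (u ^+ 2 * K u))).
  have i1 := integrable_cMl (f x) _ int_K.
  have i2 := integrable_cMl (h * taylor_slope f f2 x) _ integrable_uK.
  have i3 := integrable_cMl (h ^+ 2 / 2 * f2 x) _ integrable_uuK.
  rewrite (RintegralB measurableT (integrable_subr _ _ (integrable_subr _ _ ix i1) i2) i3).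
  rewrite (RintegralB measurableT (integrable_subr _ _ ix i1) i2) (RintegralB measurableT ix i1).
  rewrite (@RintegralZl _ _ _ leb setT K (f x) measurableT int_K) K_int1.
  rewrite (@RintegralZl _ _ _ leb setT (fun u => u * K u) _ measurableT integrable_uK) K_mean0.
  rewrite (@RintegralZl _ _ _ leb setT (fun u => u ^+ 2 * K u) _ measurableT integrable_uuK).
  rewrite -/(mu2 K) -/(kernel_mean K f h x) /bias_error mulr0 mulr1 subr0.
  by congr (_ - _); ring.
apply: eq_Rintegral => u _; rewrite /taylor_defect.
(* At u = 0 the defect takes its default value, but u ^+ 2 kills it. *)
have [->|u0] := eqVneq u 0.
  by rewrite mulr0 subr0 expr0n /=; ring.
by field; rewrite u0 h0.
Qed.

Let measurable_defect_scaled h :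
  measurable_fun setT (fun z : R * R => taylor_defect f f2 (h * z.1) z.2).
Proof.
have mp : measurable_fun setT (fun z : R * R => (h * z.1, z.2)).
  by apply: measurable_fun_pair => //; exact: measurable_funM.
exact: (measurableT_comp (measurable_taylor_defect weak) mp).
Qed.

Let theta (s : R) : \bar R := (\int[leb]_x (taylor_defect f f2 s x ^+ 2)%:E)%E.

Let theta_ge0 s : (0 <= theta s)%E.
Proof. by apply: integral_ge0 => x _; rewrite lee_fin sqr_ge0. Qed.

Let measurable_theta h : measurable_fun setT (fun u : R => theta (h * u)).
Proof.
apply: (@measurable_fun_fubini_tonelli_F _ _ (measurableTypeR R) (measurableTypeR R) R leb
  (fun z => (taylor_defect f f2 (h * z.1) z.2 ^+ 2)%:E)).
- apply/measurable_EFinP; apply: measurable_funX.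
  exact: measurable_defect_scaled.
- by move=> z; rewrite lee_fin sqr_ge0.
Qed.

Let M := fine (\int[leb]_u (u ^+ 2 * `|K u|)%:E)%E + 1.

Let M_gt0 : 0 < M.
Proof.
rewrite ltr_wpDl // fine_ge0 // integral_ge0 // => u _.
by rewrite lee_fin mulr_ge0 ?sqr_ge0.
Qed.

Let moment_norm : (\int[leb]_u `|u ^+ 2 * K u|%:E = \int[leb]_u (u ^+ 2 * `|K u|)%:E)%E.
Proof. by apply: eq_integral => u _; rewrite normrM (ger0_norm (sqr_ge0 u)). Qed.

Let moment_le : (\int[leb]_u `|u ^+ 2 * K u|%:E <= M%:E)%E.
Proof.
rewrite moment_norm -[leLHS]fineK; first by rewrite lee_fin lerDl.
rewrite ge0_fin_numE // integral_ge0 // => u _.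
by rewrite lee_fin mulr_ge0 ?sqr_ge0.
Qed.

Let bias_error_sqr h : h != 0 ->
  (\int[leb]_x (bias_error h x ^+ 2)%:E <=
   (h ^+ 4)%:E * (M%:E * \int[leb]_u (`|u ^+ 2 * K u|%:E * theta (h * u))))%E.
Proof.
move=> h0.
pose F (z : measurableTypeR R * measurableTypeR R) := h ^+ 2 * taylor_defect f f2 (h * z.1) z.2.
have mF : measurable_fun setT F.
  apply: measurable_funM => //.
  exact: measurable_defect_scaled.
have mk : measurable_fun setT (fun u : R => u ^+ 2 * K u) by apply: measurable_funM.
have CS := @integral_weighted_cauchy_schwarz _ _ (measurableTypeR R)
  (measurableTypeR R) R leb leb (fun u => u ^+ 2 * K u) F M mk mF M_gt0 moment_le.
apply: le_trans (le_trans _ CS) _.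
- rewrite le_eqVlt; apply/orP; left; apply/eqP; apply: ae_eq_integral => //.
  + by apply/measurable_EFinP; apply: measurable_funX; exact: measurable_bias_error.
  + apply/measurable_EFinP; apply: measurable_funX.
    apply: (@measurable_Rintegral _ _ (measurableTypeR R) (measurableTypeR R) R leb
      (fun z => (z.1 ^+ 2 * K z.1) * F z)).
    by apply: measurable_funM => //; exact: (measurableT_comp mk).
  + by apply: (@filterS _ _ (ae_filter_ringOfSetsType leb) _ _ _ (bias_error_ae h0)) => x -> _.
rewrite muleCA; apply: lee_wpmul2l; first by rewrite lee_fin ltW.
rewrite -ge0_integralZl //; last 3 first.
- apply: emeasurable_funM; last exact: measurable_theta.
  by apply/measurable_EFinP; exact: measurableT_comp.
- by move=> u _; rewrite mule_ge0 // lee_fin.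
- by rewrite lee_fin exprn_even_ge0.
rewrite le_eqVlt; apply/orP; left; apply/eqP; apply: eq_integral => u _.
rewrite muleCA; congr (_ * _)%E.
rewrite /theta -ge0_integralZl //; last 3 first.
- apply/measurable_EFinP; apply: measurable_funX.
  exact: (measurable_taylor_defect_section weak).
- by move=> x _; rewrite lee_fin sqr_ge0.
- by rewrite lee_fin exprn_even_ge0.
by apply: eq_integral => x _; rewrite -EFinM /F /= exprMn -exprM.
Qed.

(** The mean square is at most h^4 times an integral of u^2 |K u| against
    Taylor defects at h u: these tend to 0 for each u <> 0 and are bounded. *)
Lemma bias_error_small (h : nat -> R) :
  (forall n, 0 < h n) -> h n @[n --> \oo] --> 0 ->
  forall e : R, 0 < e -> \forall n \near \oo,
    (\int[leb]_x (bias_error (h n) x ^+ 2)%:E <= (e * h n ^+ 4)%:E)%E.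
Proof.
move=> h_gt0 h0.
have cv : (M%:E * \int[leb]_u (`|u ^+ 2 * K u|%:E * theta (h n * u)))%E @[n --> \oo] --> 0%E.
  pose A := fine (\int[leb]_x (f2 x ^+ 2)%:E)%E.
  have AE : (\int[leb]_x (f2 x ^+ 2)%:E = A%:E)%E.
    by rewrite fineK // ge0_fin_numE // integral_ge0 // => x _; rewrite lee_fin sqr_ge0.
  pose F n (u : R) := (`|u ^+ 2 * K u|%:E * theta (h n * u))%E.
  have mF n : measurable_fun setT (F n).
    apply: emeasurable_funM; last exact: measurable_theta.
    by apply/measurable_EFinP; apply: measurableT_comp => //; exact: measurable_funM.
  have H1 : {ae leb, forall u, setT u -> F ^~ u @ \oo --> (cst 0%E : R -> \bar R) u}.
    apply: aeW => u _; rewrite /F /cst; have [->|u0] := eqVneq u 0.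
      rewrite expr0n /= mul0r normr0; under eq_fun do rewrite mul0e; exact: cvg_cst.
    rewrite -[X in _ --> X](mule0 (`|u ^+ 2 * K u|%:E)).
    apply: cvgeZl => //.
    apply: (taylor_defect_cvg weak int_f f2_sqr) => [n|].
      by rewrite mulf_neq0 // gt_eqF.
    by rewrite -(mul0r u); apply: cvgM => //; exact: cvg_cst.
  have iD : leb.-integrable setT (fun u => (`|u ^+ 2 * K u|%:E * A%:E)%E).
    apply: integrableZr => //; exact: (integrable_abse integrable_uuK).
  have H2 : {ae leb, forall u n, setT u -> (`|F n u| <= `|u ^+ 2 * K u|%:E * A%:E)%E}.
    apply: aeW => u n _; rewrite gee0_abs ?mule_ge0 ?lee_fin //.
    apply: lee_wpmul2l; rewrite ?lee_fin // -AE.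
    exact: (taylor_defect_bounded weak int_f f2_sqr).
  have [_ _] := @dominated_convergence _ _ _ leb setT measurableT F (cst 0%E) _ mF
    (measurable_cst _) H1 iD H2.
  rewrite integral0 => cv; rewrite -[X in _ --> X](mule0 M%:E).
  exact: cvgeZl.
move=> e e0; move/ge0_cvge0P : cv => /(_ _ _ e0) [].
  move=> n; rewrite mule_ge0 ?lee_fin ?(ltW M_gt0) // integral_ge0 // => u _.
  by rewrite mule_ge0 // lee_fin.
move=> n0 _ Hn; exists n0 => // n /Hn {}Hn.
apply: le_trans (bias_error_sqr (lt0r_neq0 (h_gt0 n))) _.
rewrite (mulrC e) [leRHS]EFinM; apply: lee_wpmul2l => //.
by rewrite lee_fin exprn_ge0 // ltW.
Qed.

End kernel_bias.

Lemma sqr_perturbation (R : realFieldType) (a b e : R) : 0 < e ->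
  `|(a + b) ^+ 2 - b ^+ 2| <= (1 + e^-1) * a ^+ 2 + e * b ^+ 2.
Proof.
move=> e0.
have young (s : R) : s ^+ 2 = 1 -> 0 <= e^-1 * a ^+ 2 + e * b ^+ 2 - 2 * s * (a * b).
  move=> s2; have -> : e^-1 * a ^+ 2 + e * b ^+ 2 - 2 * s * (a * b) =
      e^-1 * (a - s * e * b) ^+ 2 + e * (1 - s ^+ 2) * b ^+ 2 by field; rewrite gt_eqF.
  by rewrite s2 subrr mulr0 mul0r addr0 mulr_ge0 ?sqr_ge0 // invr_ge0 ltW.
have y1 := young 1 (expr1n _ _).
have y2 : 0 <= e^-1 * a ^+ 2 + e * b ^+ 2 - 2 * (- 1) * (a * b) by apply: young; rewrite sqrrN expr1n.
have := sqr_ge0 a; rewrite ler_norml => a2; apply/andP; split; lra.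
Qed.

Lemma integral_sqr_perturbation (R : realType) (g k : R -> R) (e : R) :
  measurable_fun setT g -> measurable_fun setT k ->
  (\int[leb]_x (g x ^+ 2)%:E < +oo)%E -> (\int[leb]_x (k x ^+ 2)%:E < +oo)%E -> 0 < e ->
  `|\int[leb]_x ((g x + k x) ^+ 2) - \int[leb]_x (k x ^+ 2)| <=
  (1 + e^-1) * \int[leb]_x (g x ^+ 2) + e * \int[leb]_x (k x ^+ 2).
Proof.
move=> mg mk g2 k2 e0.
have ig : leb.-integrable setT (EFin \o (fun x => g x ^+ 2)) by exact: integrable_sqr.
have ik : leb.-integrable setT (EFin \o (fun x => k x ^+ 2)) by exact: integrable_sqr.
have mkN : measurable_fun setT (fun x => - k x) by exact: measurableT_comp.
have igk : leb.-integrable setT (EFin \o (fun x => (g x + k x) ^+ 2)).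
  apply: integrable_sqr; first exact: measurable_funD.
  have -> : (\int[leb]_x ((g x + k x) ^+ 2)%:E = \int[leb]_x ((g x - (- k x)) ^+ 2)%:E)%E.
    by apply: eq_integral => x _; rewrite opprK.
  apply: sqr_integrableB => //.
  have -> : (\int[leb]_x ((- k x) ^+ 2)%:E = \int[leb]_x (k x ^+ 2)%:E)%E => //.
  by apply: eq_integral => x _; rewrite sqrrN.
have iB : leb.-integrable setT (EFin \o (fun x => (g x + k x) ^+ 2 - k x ^+ 2)).
  by have := integrableB measurableT igk ik; apply: eq_integrable.
have iR : leb.-integrable setT (EFin \o (fun x => (1 + e^-1) * g x ^+ 2 + e * k x ^+ 2)).
  by have := integrableD measurableT (integrable_cMl (1 + e^-1) _ ig) (integrable_cMl e _ ik); apply: eq_integrable.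
rewrite -(RintegralB measurableT igk ik).
apply: le_trans (le_normr_Rintegral measurableT iB) _.
rewrite -(@RintegralZl _ _ _ leb setT _ (1 + e^-1) measurableT ig).
rewrite -(@RintegralZl _ _ _ leb setT _ e measurableT ik).
rewrite -(RintegralD measurableT (integrable_cMl (1 + e^-1) _ ig) (integrable_cMl e _ ik)).
apply: le_Rintegral => //.
  by have := integrable_abse iB; apply: eq_integrable.
by move=> x _; exact: sqr_perturbation.
Qed.

(** Passing from m - f to h^2 mu2(K) / 2 f2 changes the squared norm by at
    most (1 + t^-1) o(h^4) + t O(h^4), for any t > 0. *)
Lemma bias_expansion (R : realType) (f f2 K : R -> R) (h : nat -> R) :
  weak_second_derivative f f2 -> leb.-integrable setT (EFin \o f) ->
  (\int[leb]_x (f x ^+ 2)%:E < +oo)%E -> (\int[leb]_x (f2 x ^+ 2)%:E < +oo)%E ->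
  leb.-integrable setT (EFin \o K) -> \int[leb]_u K u = 1 -> \int[leb]_u (u * K u) = 0 ->
  (\int[leb]_u (u ^+ 2 * `|K u|)%:E < +oo)%E ->
  (forall n, 0 < h n) -> h n @[n --> \oo] --> 0 ->
  forall e, 0 < e -> \forall n \near \oo,
    `|\int[leb]_x ((kernel_mean K f (h n) x - f x) ^+ 2)
      - h n ^+ 4 / 4 * mu2 K ^+ 2 * roughness f2| <= e * h n ^+ 4.
Proof.
move=> weak int_f f_sqr f2_sqr int_K K1 K0 K2 h_gt0 h0 e e0.
have mf : measurable_fun setT f by case: weak => -[].
have mf2 : measurable_fun setT f2 by case: weak => _ [].
pose c := mu2 K / 2.
have R2_ge0 : 0 <= roughness f2 by apply: Rintegral_ge0 => x _; exact: sqr_ge0.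
have A0 : 0 < 2 * (c ^+ 2 * roughness f2 + 1).
  by rewrite mulr_gt0 // ltr_wpDl // mulr_ge0 // sqr_ge0.
(* With this t each of the two terms of the perturbation bound is at most half
   of e * h n ^+ 4. *)
pose t := e / (2 * (c ^+ 2 * roughness f2 + 1)).
have t0 : 0 < t by rewrite divr_gt0.
have D0 : 0 < 2 * (1 + t^-1) by rewrite mulr_gt0 // ltr_wpDr // invr_ge0 ltW.
have [B mB] := kernel_mean_sqr_le weak f_sqr int_K.
have small := bias_error_small weak int_f f2_sqr int_K K1 K0 K2 h_gt0 h0 (divr_gt0 e0 D0).
apply: filterS small => n small.
pose be := bias_error f f2 K (h n); pose g x := h n ^+ 2 * c * f2 x.
have mm := measurable_kernel_mean weak int_K (h n).
have mg : measurable_fun setT g by exact: measurable_funM.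
have mbe : measurable_fun setT be.
  by apply: measurable_funB => //; exact: measurable_funB.
have g_sqr : (\int[leb]_x (g x ^+ 2)%:E < +oo)%E.
  have -> : (\int[leb]_x (g x ^+ 2)%:E =
      \int[leb]_x (((h n ^+ 2 * c) ^+ 2)%:E * (f2 x ^+ 2)%:E))%E.
    by apply: eq_integral => x _; rewrite -EFinM -exprMn.
  rewrite ge0_integralZl //.
  - by rewrite lte_mul_pinfty // lee_fin sqr_ge0.
  - by apply/measurable_EFinP; exact: measurable_funX.
  - by move=> x _; rewrite lee_fin sqr_ge0.
  - by rewrite lee_fin sqr_ge0.
have be_sqr : (\int[leb]_x (be x ^+ 2)%:E < +oo)%E by exact: le_lt_trans small (ltry _).
have := integral_sqr_perturbation mbe mg be_sqr g_sqr t0.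
have -> : \int[leb]_x (g x ^+ 2) = h n ^+ 4 * (c ^+ 2 * roughness f2).
  transitivity (\int[leb]_x (h n ^+ 4 * c ^+ 2 * f2 x ^+ 2)).
    by apply: eq_Rintegral => x _; rewrite /g; ring.
  rewrite Rintegral_cMl; last exact: measurable_funX.
  by rewrite -mulrA.
have -> : \int[leb]_x ((be x + g x) ^+ 2) =
    \int[leb]_x ((kernel_mean K f (h n) x - f x) ^+ 2).
  by apply: eq_Rintegral => x _; rewrite /be /g /bias_error /c subrK.
have -> : h n ^+ 4 / 4 * mu2 K ^+ 2 * roughness f2 = h n ^+ 4 * (c ^+ 2 * roughness f2).
  by rewrite /c; field.
move=> H; apply: le_trans H _.
have be_le : \int[leb]_x (be x ^+ 2) <= e / (2 * (1 + t^-1)) * h n ^+ 4.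
  rewrite -lee_fin /Rintegral fineK // ge0_fin_numE // integral_ge0 // => x _.
  by rewrite lee_fin sqr_ge0.
have h4 : 0 <= h n ^+ 4 by rewrite exprn_ge0 // ltW.
have u0 : 0 < 1 + t^-1 by move: D0; rewrite pmulr_rgt0.
have b0 : 0 < c ^+ 2 * roughness f2 + 1 by move: A0; rewrite pmulr_rgt0.
apply: (@le_trans _ _ (e / 2 * h n ^+ 4 + e / 2 * h n ^+ 4)); last by rewrite -mulrDl -splitr.
apply: lerD.
  apply: le_trans (ler_wpM2l (ltW u0) be_le) _.
  rewrite le_eqVlt; apply/orP; left; apply/eqP; move: u0; move: (1 + t^-1) => u u0.
  by field; rewrite gt_eqF.
rewrite mulrCA mulrC; apply: ler_wpM2r => //.
rewrite /t; move: (c ^+ 2 * roughness f2) b0 => A b0.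
have -> : e / (2 * (A + 1)) * A = e / 2 * (A / (A + 1)) by field; rewrite gt_eqF.
rewrite ler_piMr ?divr_ge0 ?(ltW e0) //.
by rewrite ler_pdivrMr // mul1r lerDl.
Qed.

(** * Expectations of functions of the sample *)

Section density.
Context d (T : measurableType d) (R : realType)
  (nu mu : {sigma_finite_measure set T -> \bar R}) (f : T -> R).
Hypothesis mf : measurable_fun setT f.
Hypothesis f_ge0 : forall x, 0 <= f x.
Hypothesis nu_f : forall A, measurable A -> nu A = (\int[mu]_(x in A) (f x)%:E)%E.

(** Layer cake: g x is the length of [0, g x[, so that Tonelli's theorem
    reduces the claim to the measures of the sets where t < g. *)
Lemma ge0_integral_density (g : T -> R) :
  measurable_fun setT g -> (forall x, 0 <= g x) ->
  (\int[nu]_x (g x)%:E = \int[mu]_x (g x * f x)%:E)%E.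
Proof.
move=> mg g0.
pose S : set (T * measurableTypeR R) := [set z | 0 <= z.2] `&` [set z | z.2 < g z.1].
have mS : measurable S.
  apply: measurableI.
    rewrite [X in measurable X](_ : _ = setT `&` (@snd T (measurableTypeR R)) @^-1` `[0, +oo[%classic).
      exact: measurable_snd.
    by rewrite setTI; apply/seteqP; split => z /=; rewrite in_itv /= andbT.
  have mlt : measurable_fun setT (fun z : T * measurableTypeR R => z.2 < g z.1).
    by apply: measurable_fun_ltr => //; exact: measurableT_comp.
  by have /(_ [set true]) := mlt measurableT; rewrite setTI; exact.
have m1S : measurable_fun setT (\1_S : T * measurableTypeR R -> R) by exact: measurable_indic.
have itvE (c : R) : [set t : R | 0 <= t /\ t < c] = `[0, c[%classic.
  by apply/seteqP; split => t /=; rewrite in_itv /= => /andP.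
have secl (c : R) : 0 <= c -> (\int[leb]_t (\1_([set t : R | 0 <= t /\ t < c]) t)%:E = c%:E)%E.
  move=> c0; rewrite itvE.
  rewrite integral_indic //=.
  have H : leb (`[0, c[%classic `&` setT : set R) = c%:E.
    rewrite setIT lebesgue_measure_itv /= lte_fin; case: ltP => [_|c0']; first by rewrite sube0.
    by congr EFin; apply/eqP; rewrite eq_le c0 c0'.
  exact: H.
transitivity (\int[nu]_x \int[leb]_t (\1_S (x, t))%:E)%E.
  by apply: eq_integral => x _; rewrite -(secl (g x) (g0 x)); apply: eq_integral.
rewrite (@fubini_tonelli _ _ _ _ _ nu leb (fun z => (\1_S z)%:E)) //; last first.
  exact/measurable_EFinP.
transitivity (\int[leb]_t \int[mu]_x (\1_S (x, t) * f x)%:E)%E.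
  apply: eq_integral => t _.
  have mSt : measurable [set x | S (x, t)].
    have := measurable_ysection t mS; rewrite /ysection /=.
    by congr (measurable _); apply/seteqP; split => x /=; rewrite in_setE.
  transitivity (nu [set x | S (x, t)]).
    transitivity (\int[nu]_x (\1_([set x | S (x, t)]) x)%:E)%E; first exact: eq_integral.
    by rewrite integral_indic // setIT.
  rewrite nu_f // integral_mkcond epatch_indic; apply: eq_integral => x _.
  by rewrite -EFinM mulrC.
rewrite -(@fubini_tonelli _ _ _ _ _ mu leb (fun z => (\1_S z * f z.1)%:E)) //; last 2 first.
- apply/measurable_EFinP; apply: measurable_funM => //; exact: measurableT_comp.
- by move=> z; rewrite lee_fin mulr_ge0.
apply: eq_integral => x _ /=.
rewrite mulrC EFinM -(secl (g x) (g0 x)) -ge0_integralZl //.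
- by apply: eq_integral => t _; rewrite -EFinM mulrC.
- by apply/measurable_EFinP; rewrite itvE; exact: measurable_indic.
- by rewrite lee_fin.
Qed.

End density.

Section sampling.
Context (d : measure_display) (Omega : measurableType d) (R : realType)
  (P : probability Omega R).
Implicit Types (X Y : {RV P >-> R}) (f : R -> R).

(** X itself is valued in R with its default measurable structure, which is a
    different instance from the one that carries Lebesgue measure. *)
Definition to_borel (X : {RV P >-> R}) : {mfun Omega >-> measurableTypeR R} :=
  HB.pack (X : Omega -> measurableTypeR R)
    (isMeasurableFun.Build _ _ Omega (measurableTypeR R) X (measurable_funP X)).

(** The factor h comes from the substitution y = x - h u. *)
Lemma ge0_expectation_kernel X f (k : R -> R) (h x : R) :
  has_density X f -> 0 < h -> measurable_fun setT k -> (forall u, 0 <= k u) ->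
  (\int[P]_w (k ((x - X w) / h))%:E = h%:E * \int[leb]_u (k u * f (x - h * u))%:E)%E.
Proof.
move=> [mf f0 Xf] h0 mk k0.
have mg : measurable_fun setT (fun y : R => k ((x - y) / h)).
  apply: measurableT_comp => //; apply: measurable_funM => //; exact: measurable_funB.
rewrite -(@ge0_integral_distribution _ _ _ _ _ P (to_borel X) (fun y => (k ((x - y) / h))%:E)) //; last first.
- by move=> y; rewrite lee_fin.
- exact/measurable_EFinP.
rewrite (@ge0_integral_density _ (measurableTypeR R) R (distribution P (to_borel X)) leb f mf f0 Xf
  (fun y => k ((x - y) / h))) //.
rewrite (@ge0_integral_affine _ (- h) x (fun y => (k ((x - y) / h) * f y)%:E)).
- rewrite normrN gtr0_norm //; congr (_ * _)%E; apply: eq_integral => u _.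
  have -> : (x - (- h * u + x)) / h = u by field; exact: lt0r_neq0.
  by have -> : - h * u + x = x - h * u by ring.
- by rewrite oppr_eq0 gt_eqF.
- by apply/measurable_EFinP; exact: measurable_funM.
- by move=> y; rewrite lee_fin mulr_ge0.
Qed.

Lemma integrable_kernel_sample X f (k : R -> R) (h x : R) :
  has_density X f -> 0 < h -> measurable_fun setT k ->
  leb.-integrable setT (EFin \o (fun u => k u * f (x - h * u))) ->
  P.-integrable setT (EFin \o (fun w => k ((x - X w) / h))).
Proof.
move=> Xf h0 mk /integrableP[_ ik]; have [mf f0 _] := Xf.
have mX : measurable_fun setT (fun w => k ((x - X w) / h)).
  apply: measurableT_comp => //; apply: measurable_funM => //; exact: measurable_funB.
apply/integrableP; split; first exact/measurable_EFinP.
have mak : measurable_fun setT (fun u => `|k u|) by exact: measurableT_comp.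
have := @ge0_expectation_kernel X f (fun u => `|k u|) h x Xf h0 mak (fun u => normr_ge0 _).
move=> /= ->; rewrite lte_mul_pinfty ?lee_fin ?(ltW h0) //.
apply: le_lt_trans ik; rewrite le_eqVlt; apply/orP; left; apply/eqP.
by apply: eq_integral => u _; rewrite /= normrM (ger0_norm (f0 _)).
Qed.

Lemma expectation_kernel X f (k : R -> R) (h x : R) :
  has_density X f -> 0 < h -> measurable_fun setT k ->
  leb.-integrable setT (EFin \o (fun u => k u * f (x - h * u))) ->
  \int[P]_w k ((x - X w) / h) = h * \int[leb]_u (k u * f (x - h * u)).
Proof.
move=> Xf h0 mk ik; have [mf f0 _] := Xf.
have mp : measurable_fun setT (k^\+) by exact: measurable_funrpos.
have mn : measurable_fun setT (k^\-) by exact: measurable_funrneg.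
have mfx : measurable_fun setT (fun u => f (x - h * u)).
  apply: measurableT_comp => //; apply: measurable_funB => //; exact: measurable_funM.
have kE u : k u = k^\+ u - k^\- u by exact: esym (congr1 (fun g => g u) (funrposBneg k)).
have le_int (g : R -> R) : measurable_fun setT g -> (forall u, `|g u| <= `|k u|) ->
    leb.-integrable setT (EFin \o (fun u => g u * f (x - h * u))).
  move=> mg gk; apply: le_integrable ik => //.
    by apply/measurable_EFinP; exact: measurable_funM.
  by move=> u _; rewrite /= lee_fin !normrM ler_wpM2r.
have pk u : `|k^\+ u| <= `|k u|.
  by rewrite ger0_norm ?funrpos_ge0 // /funrpos ge_max ler_norm normr_ge0.
have nk u : `|k^\- u| <= `|k u|.
  by rewrite ger0_norm ?funrneg_ge0 // /funrneg ge_max -normrN ler_norm normr_ge0.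
have ip := le_int _ mp pk; have in_ := le_int _ mn nk.
have E (g : R -> R) : measurable_fun setT g -> (forall u, 0 <= g u) ->
    \int[P]_w g ((x - X w) / h) = h * \int[leb]_u (g u * f (x - h * u)).
  move=> mg g0; rewrite /Rintegral (@ge0_expectation_kernel X f g h x Xf h0 mg g0).
  by case: (\int[leb]_u _)%E => [r||] //=; rewrite ?gt0_muley ?gt0_muleNy ?lte_fin //= mulr0.
transitivity (\int[P]_w (k^\+ ((x - X w) / h) - k^\- ((x - X w) / h))).
  by apply: eq_Rintegral => w _; rewrite -kE.
rewrite (RintegralB measurableT (integrable_kernel_sample Xf h0 mp ip)
  (integrable_kernel_sample Xf h0 mn in_)).
rewrite (E _ mp) ?(E _ mn); [|exact: funrneg_ge0|exact: funrpos_ge0].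
rewrite -mulrBr -(RintegralB measurableT ip in_); congr (_ * _).
by apply: eq_Rintegral => u _; rewrite -mulrBl -kE.
Qed.

Definition pair_independent X Y :=
  forall A B : set R, measurable A -> measurable B ->
    P (X @^-1` A `&` Y @^-1` B) = (P (X @^-1` A) * P (Y @^-1` B))%E.

(** Mutual independence over the index list [:: i; j]. *)
Lemma mutually_independent_pair (Z : nat -> {RV P >-> R}) (i j : nat) :
  mutually_independent Z -> i != j -> pair_independent (Z i) (Z j).
Proof.
move=> indep ij A B mA mB.
have mAB k : measurable ((fun k => if k == i then A else B) k) by case: ifP.
have := indep [:: i; j] (fun k => if k == i then A else B) _ mAB.
rewrite /= inE ij => /(_ isT); rewrite !big_cons big_nil mule1 eqxx.
rewrite eq_sym (negbTE ij) => <-; congr (P _); apply/seteqP; split => w /=.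
- by move=> [wA wB] k /=; rewrite !inE => /orP[|] /eqP ->;
    rewrite ?eqxx // eq_sym (negbTE ij).
- move=> H; split.
    by have := H i; rewrite /= inE eqxx /=; exact.
  by have := H j; rewrite /= !inE eqxx orbT eq_sym (negbTE ij); exact.
Qed.

(** Independence says that the joint law is the product of the laws, as both
    measures agree on rectangles. *)
Lemma expectation_independent_mul X Y (g1 g2 : R -> R) :
  pair_independent X Y -> measurable_fun setT g1 -> measurable_fun setT g2 ->
  P.-integrable setT (EFin \o (fun w => g1 (X w))) ->
  P.-integrable setT (EFin \o (fun w => g2 (Y w))) ->
  P.-integrable setT (EFin \o (fun w => g1 (X w) * g2 (Y w))) ->
  \int[P]_w (g1 (X w) * g2 (Y w)) = (\int[P]_w g1 (X w)) * (\int[P]_w g2 (Y w)).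
Proof.
move=> XY mg1 mg2 i1 i2 i12.
pose phi (w : Omega) : R * R := (X w, Y w).
have mphi : measurable_fun setT phi by exact: measurable_fun_pair.
pose F (z : R * R) := g1 z.1 * g2 z.2.
have mF : measurable_fun setT F by apply: measurable_funM; exact: measurableT_comp.
have law A : measurable A ->
    (distribution P X \x distribution P Y)%E A = image_measure P mphi A.
  by apply: product_measure_unique => B C mB mC; rewrite -XY.
have law_integral (G : R * R -> \bar R) :
    (\int[image_measure P mphi]_z G z = \int[(distribution P X \x distribution P Y)%E]_z G z)%E.
  by apply: eq_measure_integral => A mA _; exact: esym (law _ mA).
have iF : (distribution P X \x distribution P Y)%E.-integrable setT (EFin \o F).
  apply/integrableP; split; first exact/measurable_EFinP.
  rewrite -law_integral ge0_integral_pushforward //; last first.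
    by apply: measurableT_comp => //; exact/measurable_EFinP.
  by case/integrableP : i12.
have EX : (\int[distribution P X]_y (g1 y)%:E = \int[P]_w (g1 (X w))%:E)%E.
  by rewrite integral_distribution //; exact/measurable_EFinP.
have EY : (\int[distribution P Y]_y (g2 y)%:E = \int[P]_w (g2 (Y w))%:E)%E.
  by rewrite integral_distribution //; exact/measurable_EFinP.
rewrite /Rintegral.
transitivity (fine (\int[(distribution P X \x distribution P Y)%E]_z (F z)%:E)).
  congr fine; rewrite -law_integral integral_pushforward //.
  exact/measurable_EFinP.
rewrite -(integral12_prod_meas1 iF).
have idX : (distribution P X).-integrable setT (EFin \o g1).
  apply: integrable_pushforward => //; exact/measurable_EFinP.
have idY : (distribution P Y).-integrable setT (EFin \o g2).
  apply: integrable_pushforward => //; exact/measurable_EFinP.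
have f1 := integrable_fin_num measurableT i1.
have f2 := integrable_fin_num measurableT i2.
have fY : (\int[distribution P Y]_y (g2 y)%:E =
    (fine (\int[distribution P Y]_y (g2 y)%:E))%:E)%E by rewrite fineK // EY.
rewrite -fineM // -EX -EY fY -integralZr //.
congr fine; apply: eq_integral => y _.
by rewrite /fubini_F /F /= -fY -integralZl.
Qed.

(** Of the n^2 products in the square, n are diagonal. *)
Lemma expectation_sqr_sum (W : nat -> Omega -> R) (a2 b : R) (n : nat) :
  (forall i j, P.-integrable setT (EFin \o (fun w => W i w * W j w))) ->
  (forall i, \int[P]_w (W i w * W i w) = b) ->
  (forall i j, i != j -> \int[P]_w (W i w * W j w) = a2) ->
  \int[P]_w ((\sum_(i < n) W i w) ^+ 2) = n%:R * b + n%:R * (n%:R - 1) * a2 /\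
  P.-integrable setT (EFin \o (fun w => (\sum_(i < n) W i w) ^+ 2)).
Proof.
move=> iW Eb Ea.
have cross j m : (m <= j)%N ->
    \int[P]_w ((\sum_(i < m) W i w) * W j w) = m%:R * a2 /\
    P.-integrable setT (EFin \o (fun w => (\sum_(i < m) W i w) * W j w)).
  elim: m => [_|m IH mj].
    have E0 : (fun w => (\sum_(i < 0) W i w) * W j w) = cst 0.
      by apply/funext => w; rewrite big_ord0 mul0r.
    rewrite E0; split; first by rewrite Rintegral_cst // !mul0r.
    exact: integrable0.
  have [E1 i1] := IH (ltnW mj).
  have E : (fun w => (\sum_(i < m.+1) W i w) * W j w) =
      (fun w => (\sum_(i < m) W i w) * W j w + W m w * W j w).
    by apply/funext => w; rewrite big_ord_recr /= mulrDl.
  rewrite E; split; last by have := integrableD measurableT i1 (iW m j); apply: eq_integrable.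
  rewrite (RintegralD measurableT i1 (iW m j)) E1 Ea; last by rewrite neq_ltn mj.
  by rewrite -natr1; ring.
elim: n => [|n [IE Ii]].
  have E0 : (fun w => (\sum_(i < 0) W i w) ^+ 2) = cst 0.
    by apply/funext => w; rewrite big_ord0 expr0n.
  rewrite E0; split; first by rewrite Rintegral_cst // !mul0r addr0.
  exact: integrable0.
have [E1 i1] := cross n n (leqnn n).
have E : (fun w => (\sum_(i < n.+1) W i w) ^+ 2) =
    (fun w => (\sum_(i < n) W i w) ^+ 2 + 2 * ((\sum_(i < n) W i w) * W n w) + W n w * W n w).
  by apply/funext => w; rewrite big_ord_recr /=; ring.
have i2 : P.-integrable setT (EFin \o (fun w => 2 * ((\sum_(i < n) W i w) * W n w))).
  by have := integrableZl measurableT 2 i1; apply: eq_integrable.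
have i3 : P.-integrable setT (EFin \o (fun w =>
    (\sum_(i < n) W i w) ^+ 2 + 2 * ((\sum_(i < n) W i w) * W n w))).
  by have := integrableD measurableT Ii i2; apply: eq_integrable.
rewrite E; split; last by have := integrableD measurableT i3 (iW n n); apply: eq_integrable.
rewrite (RintegralD measurableT i3 (iW n n)) (RintegralD measurableT Ii i2).
rewrite (@RintegralZl _ _ _ P setT _ 2 measurableT i1) E1 IE Eb -natr1; ring.
Qed.

End sampling.

(** * The mean square error *)

Section mean_square_error.
Context (d : measure_display) (Omega : measurableType d) (R : realType)
  (P : probability Omega R) (X : nat -> {RV P >-> R}) (f K : R -> R).
Hypothesis X_indep : mutually_independent X.
Hypothesis X_density : forall i, has_density (X i) f.
Hypothesis mK : measurable_fun setT K.

Let mf : measurable_fun setT f. Proof. by have [] := X_density 0. Qed.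
Let f_ge0 x : 0 <= f x. Proof. by have [] := X_density 0. Qed.

Lemma density_integral1 : (\int[leb]_x (f x)%:E = 1)%E.
Proof.
have [_ _ /(_ setT measurableT)] := X_density 0.
by rewrite probability_setT.
Qed.

Lemma integrable_density : leb.-integrable setT (EFin \o f).
Proof.
apply/integrableP; split; first exact/measurable_EFinP.
have -> : (\int[leb]_x `|(EFin \o f) x| = 1)%E; last by rewrite ltry.
by rewrite -[RHS]density_integral1; apply: eq_integral => x _; rewrite /= ger0_norm.
Qed.

Variable h : R.
Hypothesis h_gt0 : 0 < h.

Let integrable_density_scaled x : leb.-integrable setT (EFin \o (fun u => f (x - h * u))).
Proof.
have hn0 : - h != 0 by rewrite oppr_eq0 gt_eqF.
have := integrable_affine x hn0 integrable_density.
by apply: eq_integrable => // u _; rewrite /= mulNr addrC.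
Qed.

Let density_scaled_integral x : \int[leb]_u f (x - h * u) = h^-1.
Proof.
have hn0 : - h != 0 by rewrite oppr_eq0 gt_eqF.
have := Rintegral_affine x hn0 mf.
rewrite normrN gtr0_norm // [in RHS]/Rintegral density_integral1 mulr1 => <-.
by apply: eq_Rintegral => u _; rewrite mulNr addrC.
Qed.

(** The deviation from f x is the average of the centered variables
    h^-1 K ((x - X i) / h) - f x, which are functions of (x - X i) / h as well.
    The two integrability hypotheses hold for almost every x. *)
Lemma mean_square_error_pointwise n x : (0 < n)%N ->
  leb.-integrable setT (EFin \o (fun u => K u * f (x - h * u))) ->
  leb.-integrable setT (EFin \o (fun u => K u ^+ 2 * f (x - h * u))) ->
  (\int[P]_w ((kde K X n h w x - f x) ^+ 2)%:E =
   ((kernel_mean K f h x - f x) ^+ 2 +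
    (h^-1 * \int[leb]_u (K u ^+ 2 * f (x - h * u)) - kernel_mean K f h x ^+ 2) / n%:R)%:E)%E.
Proof.
move=> n0 i1 i2.
have hn0 : h != 0 by rewrite gt_eqF.
have n0R : (n%:R : R) != 0 by rewrite pnatr_eq0 -lt0n.
pose k u := h^-1 * K u - f x.
have mk : measurable_fun setT k.
  by apply: measurable_funB => //; apply: measurable_funM.
have mk2 : measurable_fun setT (fun u => k u * k u) by exact: measurable_funM.
have i0 := integrable_density_scaled x.
have RZ (c : R) (g : R -> R) : leb.-integrable setT (EFin \o g) ->
    \int[leb]_u (c * g u) = c * \int[leb]_u g u.
  by move=> ig; exact: (@RintegralZl _ _ _ leb setT g c measurableT ig).
set m := kernel_mean K f h x.
set v := h^-1 * _.
have ik : leb.-integrable setT (EFin \o (fun u => k u * f (x - h * u))).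
  have := integrable_subr _ _ (integrable_cMl h^-1 _ i1) (integrable_cMl (f x) _ i0); apply: eq_integrable => // u _.
  by rewrite /= /k mulrBl mulrA.
have ik2 : leb.-integrable setT (EFin \o (fun u => (k u * k u) * f (x - h * u))).
  have := integrable_addr _ _ (integrable_subr _ _ (integrable_cMl (h^-1 ^+ 2) _ i2) (integrable_cMl (2 * f x * h^-1) _ i1)) (integrable_cMl (f x ^+ 2) _ i0).
  by apply: eq_integrable => // u _; rewrite /= /k; congr EFin; ring.
have mean_k : h * \int[leb]_u (k u * f (x - h * u)) = m - f x.
  transitivity (h * \int[leb]_u (h^-1 * (K u * f (x - h * u)) - f x * f (x - h * u))).
    by congr (_ * _); apply: eq_Rintegral => u _; rewrite /k mulrBl mulrA.
  rewrite (RintegralB measurableT (integrable_cMl h^-1 _ i1) (integrable_cMl (f x) _ i0)) (RZ _ _ i1) (RZ _ _ i0).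
  by rewrite density_scaled_integral -/(kernel_mean K f h x) -/m; field.
have sqr_k : h * \int[leb]_u ((k u * k u) * f (x - h * u)) = v - 2 * f x * m + f x ^+ 2.
  transitivity (h * \int[leb]_u (h^-1 ^+ 2 * (K u ^+ 2 * f (x - h * u))
      - (2 * f x * h^-1) * (K u * f (x - h * u)) + f x ^+ 2 * f (x - h * u))).
    by congr (_ * _); apply: eq_Rintegral => u _; rewrite /k; ring.
  rewrite (RintegralD measurableT (integrable_subr _ _ (integrable_cMl (h^-1 ^+ 2) _ i2) (integrable_cMl (2 * f x * h^-1) _ i1))
    (integrable_cMl (f x ^+ 2) _ i0)).
  rewrite (RintegralB measurableT (integrable_cMl (h^-1 ^+ 2) _ i2) (integrable_cMl (2 * f x * h^-1) _ i1)).
  rewrite (RZ _ _ i2) (RZ _ _ i1) (RZ _ _ i0) density_scaled_integral.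
  by rewrite -/(kernel_mean K f h x) -/m /v; field.
pose W i w := k ((x - X i w) / h).
have mW i : measurable_fun setT (W i).
  by apply: measurableT_comp => //; apply: measurable_funM => //; exact: measurable_funB.
have iWW i : P.-integrable setT (EFin \o (fun w => W i w * W i w)).
  exact: (integrable_kernel_sample (X_density i) h_gt0 mk2 ik2).
have iWij i j : P.-integrable setT (EFin \o (fun w => W i w * W j w)).
  have fin i' : (\int[P]_w (W i' w ^+ 2)%:E < +oo)%E.
    have [_] := integrableP _ _ _ (iWW i'); apply: le_lt_trans.
    rewrite le_eqVlt; apply/orP; left; apply/eqP; apply: eq_integral => w _.
    by rewrite /= -expr2 ger0_norm ?sqr_ge0.
  exact: integrable_sqr_mul.
have Eb i : \int[P]_w (W i w * W i w) = v - 2 * f x * m + f x ^+ 2.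
  by rewrite -sqr_k -(expectation_kernel (X_density i) h_gt0 mk2 ik2).
have Ea i j : i != j -> \int[P]_w (W i w * W j w) = (m - f x) ^+ 2.
  move=> ij.
  have mg : measurable_fun setT (fun y : R => k ((x - y) / h)).
    by apply: measurableT_comp => //; apply: measurable_funM => //; exact: measurable_funB.
  rewrite (@expectation_independent_mul _ _ _ P (X i) (X j) (fun y => k ((x - y) / h))
    (fun y => k ((x - y) / h)) (mutually_independent_pair X_indep ij) mg mg _ _ (iWij i j)).
  - by rewrite !(expectation_kernel (X_density _) h_gt0 mk ik) mean_k expr2.
  - exact: (integrable_kernel_sample (X_density i) h_gt0 mk ik).
  - exact: (integrable_kernel_sample (X_density j) h_gt0 mk ik).
have [ES iS] := expectation_sqr_sum n iWij Eb Ea.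
have kdeE w : (kde K X n h w x - f x) ^+ 2 = (n%:R ^+ 2)^-1 * (\sum_(i < n) W i w) ^+ 2.
  have -> : \sum_(i < n) W i w = h^-1 * \sum_(i < n) K ((x - X i w) / h) - n%:R * f x.
    by rewrite sumrB big_distrr /= sumr_const card_ord mulr_natl.
  by rewrite /kde; field; rewrite n0R hn0.
have iSn : P.-integrable setT (EFin \o (fun w => (n%:R ^+ 2)^-1 * (\sum_(i < n) W i w) ^+ 2)).
  by have := integrableZl measurableT (n%:R ^+ 2)^-1 iS; apply: eq_integrable.
rewrite (eq_integral (fun w => ((n%:R ^+ 2)^-1 * (\sum_(i < n) W i w) ^+ 2)%:E)); last first.
  by move=> w _; rewrite kdeE.
rewrite -[LHS]fineK; last exact: integrable_fin_num.
rewrite -/(Rintegral P setT _) (@RintegralZl _ _ _ P setT _ _ measurableT iS) ES.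
by congr EFin; field.
Qed.

Hypothesis int_K : leb.-integrable setT (EFin \o K).
Hypothesis K_sqr : (\int[leb]_u (K u ^+ 2)%:E < +oo)%E.
Hypothesis f_sqr : (\int[leb]_x (f x ^+ 2)%:E < +oo)%E.

Let measurable_mean : measurable_fun setT (kernel_mean K f h).
Proof.
apply: (@measurable_Rintegral _ _ (measurableTypeR R) (measurableTypeR R) R leb
  (fun z => K z.1 * f (z.2 - h * z.1))).
have [mE _] := integrableP _ _ _ (integrable_kernel_product h int_K integrable_density).
exact/measurable_EFinP.
Qed.

Lemma mise_decomposition n : (0 < n)%N ->
  (\int[leb]_x (kernel_mean K f h x ^+ 2)%:E < +oo)%E ->
  MISE P K X f n h =
  (\int[leb]_x ((kernel_mean K f h x - f x) ^+ 2) +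
   (h^-1 * roughness K - \int[leb]_x (kernel_mean K f h x ^+ 2)) / n%:R)%:E.
Proof.
move=> n0 m_sqr.
have iK2 : leb.-integrable setT (EFin \o (fun u => K u ^+ 2)) by exact: integrable_sqr.
have int_f := integrable_density.
have p1 := integrable_kernel_product h int_K int_f.
have p2 := integrable_kernel_product h iK2 int_f.
have mkde : measurable_fun setT (fun z : Omega * measurableTypeR R =>
    ((kde K X n h z.1 z.2 - f z.2) ^+ 2)%:E).
  apply/measurable_EFinP; apply: measurable_funX; apply: measurable_funB; last first.
    exact: measurableT_comp.
  apply: measurable_funM => //.
  rewrite [X in measurable_fun _ X](_ : _ = (fun z : Omega * measurableTypeR R =>
    \sum_(i <- index_enum 'I_n) K ((z.2 - X i z.1) / h))) //.
  apply: measurable_sum => i; apply: measurableT_comp => //.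
  apply: measurable_funM => //; apply: measurable_funB => //.
  exact: (measurableT_comp (measurable_funP (X i))).
rewrite /MISE (@fubini_tonelli _ _ Omega (measurableTypeR R) R P leb
  (fun z => ((kde K X n h z.1 z.2 - f z.2) ^+ 2)%:E)) //; last first.
  by move=> z; rewrite lee_fin sqr_ge0.
pose v x := h^-1 * \int[leb]_u (K u ^+ 2 * f (x - h * u)).
pose b x := (kernel_mean K f h x - f x) ^+ 2.
pose m2 x := kernel_mean K f h x ^+ 2.
have iv0 := integrable_Rintegral2 p2.
have iv : leb.-integrable setT (EFin \o v).
  by have := integrableZl measurableT h^-1 iv0; apply: eq_integrable.
have im : leb.-integrable setT (EFin \o m2) by exact: integrable_sqr.
have ib : leb.-integrable setT (EFin \o b).
  apply: integrable_sqr; first exact: measurable_funB.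
  exact: sqr_integrableB.
have ivm : leb.-integrable setT (EFin \o (fun x => v x - m2 x)).
  by have := integrableB measurableT iv im; apply: eq_integrable.
have ivmn : leb.-integrable setT (EFin \o (fun x => (v x - m2 x) * n%:R^-1)).
  by have := integrableZr measurableT n%:R^-1 ivm; apply: eq_integrable.
have iall : leb.-integrable setT (EFin \o (fun x => b x + (v x - m2 x) * n%:R^-1)).
  by have := integrableD measurableT ib ivmn; apply: eq_integrable.
transitivity (\int[leb]_x (b x + (v x - m2 x) * n%:R^-1)%:E)%E.
  apply: ae_eq_integral => //.
  - apply: (@measurable_fun_fubini_tonelli_G _ _ Omega (measurableTypeR R) R P
      (fun z => ((kde K X n h z.1 z.2 - f z.2) ^+ 2)%:E)) => //.
    by move=> z; rewrite lee_fin sqr_ge0.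
  - by case/integrableP: iall.
  - apply: (@filterS2 _ _ (ae_filter_ringOfSetsType leb) _ _ _ _ (ae_integrable2 p1)
      (ae_integrable2 p2)) => x i1 i2 _.
    exact: mean_square_error_pointwise.
rewrite -[LHS]fineK; last exact: integrable_fin_num.
rewrite -/(Rintegral leb setT _); congr EFin.
rewrite (RintegralD measurableT ib ivmn) (@RintegralZr _ _ _ leb setT _ _ measurableT ivm).
rewrite (RintegralB measurableT iv im); congr (_ + (_ - _) / _).
rewrite (@RintegralZl _ _ _ leb setT _ h^-1 measurableT iv0); congr (_ * _).
rewrite -(Rintegral_fubini p2) /roughness; apply: eq_Rintegral => u _ /=.
have mfu : measurable_fun setT (fun x : R => f (x - h * u)) by exact: measurable_translate.
rewrite Rintegral_cMl // -[RHS]mulr1; congr (_ * _).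
rewrite (Rintegral_translate (- (h * u)) mf) /Rintegral density_integral1 //.
Qed.

End mean_square_error.

(** * The expansion of the mean integrated squared error *)

Unset Implicit Arguments.

Theorem theorem4p3 (R : realType) (d : measure_display)
    (Omega : measurableType d) (P : probability Omega R)
    (X : nat -> {RV P >-> R}) (f f2 K : R -> R) (h : nat -> R)
    (X_indep : mutually_independent X)
    (X_density : forall i, has_density (X i) f)
    (f_L2 : f \in Lfun lebesgue_measure 2%:E)
    (f2_weak : weak_second_derivative f f2)
    (f2_L2 : f2 \in Lfun lebesgue_measure 2%:E)
    (K_L1 : K \in Lfun lebesgue_measure 1%:E)
    (K_L2 : K \in Lfun lebesgue_measure 2%:E)
    (K_int1 : \int[lebesgue_measure]_u K u = 1)
    (K_mean0 : \int[lebesgue_measure]_u (u * K u) = 0)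
    (K_moment2 :
       (\int[lebesgue_measure]_u (u ^+ 2 * `|K u|)%:E < +oo)%E)
    (h_gt0 : forall n, (0 < n)%N -> 0 < h n)
    (h_to0 : h n @[n --> \oo] --> 0)
    (nh_toy : n%:R * h n @[n --> \oo] --> +oo) :
  (exists r s : nat -> R,
     [/\ r =o_\oo (fun n => h n ^+ 4),
         s =O_\oo (fun n => n%:R^-1 : R) &
         forall n, (0 < n)%N ->
           MISE P K X f n (h n) =
           (h n ^+ 4 / 4 * mu2 K ^+ 2 * roughness f2
            + roughness K / (n%:R * h n) + r n + s n)%:E]) /\
  (exists r : nat -> R,
     r =o_\oo (fun n => h n ^+ 4 + (n%:R * h n)^-1) /\
     forall n, (0 < n)%N ->
       MISE P K X f n (h n) =
       (h n ^+ 4 / 4 * mu2 K ^+ 2 * roughness f2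
        + roughness K / (n%:R * h n) + r n)%:E).
Proof.
have sqr_lty (g : R -> R) : g \in Lfun lebesgue_measure 2%:E ->
    (\int[leb]_x (g x ^+ 2)%:E < +oo)%E.
  move=> /Lfun2_integrable_sqr /integrableP[_]; apply: le_lt_trans.
  rewrite le_eqVlt; apply/orP; left; apply/eqP; apply: eq_integral => x _.
  by rewrite /= ger0_norm ?sqr_ge0.
have f_sqr := sqr_lty f f_L2; have f2_sqr := sqr_lty f2 f2_L2; have K_sqr := sqr_lty K K_L2.
have int_K : leb.-integrable setT (EFin \o K) by apply/Lfun1_integrable.
have mK : measurable_fun setT K by case/integrableP: int_K => /measurable_EFinP.
have int_f := integrable_density X_density.
have [B mB] := kernel_mean_sqr_le f2_weak f_sqr int_K.
have B0 : 0 <= B.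
  rewrite -lee_fin; apply: le_trans (mB 0); apply: integral_ge0 => x _.
  by rewrite lee_fin sqr_ge0.
pose m2 n := \int[leb]_x (kernel_mean K f (h n) x ^+ 2).
have m2_ge0 n : 0 <= m2 n by apply: Rintegral_ge0 => x _; exact: sqr_ge0.
have m2_le n : m2 n <= B.
  rewrite -lee_fin /m2 /Rintegral fineK // ge0_fin_numE ?integral_ge0 //.
    exact: le_lt_trans (mB _) (ltry _).
  by move=> x _; rewrite lee_fin sqr_ge0.
pose r n := \int[leb]_x ((kernel_mean K f (h n) x - f x) ^+ 2)
  - h n ^+ 4 / 4 * mu2 K ^+ 2 * roughness f2.
pose s n : R := - m2 n / n%:R.
have pos : \forall n \near \oo, (0 < n)%N by exists 1%N.
(* the value of h at 0 is unconstrained *)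
pose h' n := if n == 0%N then 1 else h n.
have h'_gt0 n : 0 < h' n.
  by rewrite /h'; case: eqP => // /eqP n0; rewrite h_gt0 // lt0n.
have h'0 : h' n @[n --> \oo] --> 0.
  apply: cvg_trans h_to0; apply: near_eq_cvg.
  by apply: filterS pos => n; rewrite lt0n /h' => /negbTE ->.
have r_small e : 0 < e -> \forall n \near \oo, `|r n| <= e * h n ^+ 4.
  move=> e0; have H := bias_expansion f2_weak int_f f_sqr f2_sqr int_K K_int1 K_mean0
    K_moment2 h'_gt0 h'0 e0.
  by apply: filterS2 pos H => n; rewrite lt0n /h' => /negbTE ->.
have s_le n : `|s n| <= B * `|n%:R^-1|.
  by rewrite /s normrM normrN (ger0_norm (m2_ge0 n)) ler_wpM2r.
have mise n : (0 < n)%N -> MISE P K X f n (h n) =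
    (h n ^+ 4 / 4 * mu2 K ^+ 2 * roughness f2
     + roughness K / (n%:R * h n) + r n + s n)%:E.
  move=> n0; have hn0 : h n != 0 by rewrite gt_eqF ?h_gt0.
  have nR0 : (n%:R : R) != 0 by rewrite pnatr_eq0 -lt0n.
  rewrite (mise_decomposition X_indep X_density mK (h_gt0 n n0) int_K K_sqr f_sqr n0).
    by congr EFin; rewrite /r /s -/(m2 n); field; rewrite ?hn0 ?nR0.
  exact: le_lt_trans (mB _) (ltry _).
split.
  exists r, s; split => //.
  - apply/eqoP => e e0; apply: filterS (r_small e e0) => n rn.
    by rewrite (ger0_norm (exprn_even_ge0 _ _)).
  - apply/eqOP; near=> k; apply: nearW => n; apply: le_trans (s_le n) _.
    by rewrite ler_wpM2r //; near: k; apply: nbhs_pinfty_ge; exact: num_real.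
exists (fun n => r n + s n); split; last first.
  by move=> n n0; rewrite mise //; congr EFin; rewrite [RHS]addrA.
apply/eqoP => e e0.
(* s n is O(n^-1), and n^-1 is (n h n)^-1 times h n, which tends to 0. *)
have e1 : 0 < e / (B + 1) by rewrite divr_gt0 // ltr_wpDl.
have h_small : \forall n \near \oo, h n <= e / (B + 1).
  have /cvgrPdist_le /(_ _ e1) := h_to0; apply: filterS => n.
  by rewrite sub0r normrN; apply: le_trans; exact: ler_norm.
apply: filterS3 pos h_small (r_small e e0) => n n0 hn rn.
have hn0 := h_gt0 n n0; have nR : (0 : R) < n%:R by rewrite ltr0n.
rewrite [X in _ <= _ * X]ger0_norm; last first.
  by rewrite addr_ge0 ?exprn_ge0 ?invr_ge0 ?mulr_ge0 // ltW.
apply: le_trans (ler_normD _ _) _; rewrite mulrDr; apply: lerD => //.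
apply: le_trans (s_le n) _; rewrite gtr0_norm ?invr_gt0 //.
have -> : e * (n%:R * h n)^-1 = e / h n * n%:R^-1 by rewrite invfM; ring.
rewrite ler_wpM2r ?invr_ge0 ?(ltW nR) // ler_pdivlMr //.
apply: le_trans (ler_wpM2l B0 hn) _; rewrite mulrCA ler_piMr ?(ltW e0) //.
by rewrite ler_pdivrMr ?mul1r ?lerDl // ltr_wpDl.
Unshelve. all: by end_near. Qed.
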